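(* Let $m_{13},m_{23},m_{33}$ be complex numbers with $m_{13}-m_{23}\in\mathbf{Z}_+$, and let $l_{13}=m_{13}-1$, $l_{23}=m_{23}-2$, $l_{33}=m_{33}-1$. The finite-dimensional representation of $U_q[gl(2/1)]$ in the induced module $W^q([m_{13},m_{23},m_{33}])$ (given by the explicit matrix elements in the reduced basis listed in the context) is irreducible (and is then called typical) if and only if $$[l_{13}+l_{33}+3]\,[l_{23}+l_{33}+3]\neq 0 .$$
   Context: Let $q$ be a nonzero complex number that is not a root of unity; fix $h$ with $e^h=q$ and put $q^x=e^{hx}$, $[x]=(q^x-q^{-x})/(q-q^{-1})$. Put $[A,B]=AB-BA$, $\{A,B\}=AB+BA$, $[A,B]_r=AB-rBA$, $\mathbf{Z}_+=\{0,1,2,\dots\}$. The quantum superalgebra $U_q=U_q[gl(2/1)]$ is the associative unital complex superalgebra generated by even elements $E_{11},E_{22},E_{33},E_{12},E_{21}$ and odd elements $E_{23},E_{32}$ (together with invertible elements $q^{\pm E_{ii}}$, behaving as exponentials of $\pm hE_{ii}$: they commute with each other and with all $E_{jj}$, satisfy $q^{E_{ii}}E_{j,j+1}=q^{\delta_{ij}-\delta_{i,j+1}}E_{j,j+1}q^{E_{ii}}$ and $q^{E_{ii}}E_{j+1,j}=q^{\delta_{i,j+1}-\delta_{ij}}E_{j+1,j}q^{E_{ii}}$), subject to: $[E_{ii},E_{jj}]=0$; $[E_{ii},E_{j,j+1}]=(\delta_{ij}-\delta_{i,j+1})E_{j,j+1}$; $[E_{ii},E_{j+1,j}]=(\delta_{i,j+1}-\delta_{ij})E_{j+1,j}$;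 $[E_{12},E_{21}]=[H_1]$; $\{E_{23},E_{32}\}=[H_2]$; $[E_{12},E_{32}]=[E_{21},E_{23}]=0$; $E_{23}^2=E_{32}^2=0$; $[E_{12},E_{13}]_q=[E_{21},E_{31}]_q=0$. Here $H_1=E_{11}-E_{22}$, $H_2=E_{22}+E_{33}$, $[H_i]=(q^{H_i}-q^{-H_i})/(q-q^{-1})$, and $E_{13}:=[E_{12},E_{23}]_{q^{-1}}$, $E_{31}:=-[E_{21},E_{32}]_{q^{-1}}$. The even subalgebra $U_q[gl(2/1)_0]\equiv U_q[gl(2)\oplus gl(1)]$ is the subalgebra generated by $E_{12},E_{21}$ and $E_{ii}$ (and $q^{\pm E_{ii}}$), $i=1,2,3$; on modules $q^{\pm E_{ii}}$ acts as $e^{\pm hE_{ii}}$. $U_q(B)$ is the subalgebra generated by $U_q[gl(2/1)_0]$, $E_{13}$ and $E_{23}$. For complex $m_{12},m_{22},m_{32}$ with $m_{12}-m_{22}\in\mathbf{Z}_+$, $V^q([m_{12},m_{22},m_{32}])$ is the irreducible $U_q[gl(2/1)_0]$-module with (Gel'fand–Zetlin) basis of vectors labelled by $m_{11}$ with $m_{12}-m_{11},\,m_{11}-m_{22}\in\mathbf{Z}_+$, and action $E_{11}(m)=m_{11}(m)$, $E_{22}(m)=(m_{12}+m_{22}-m_{11})(m)$, $E_{33}(m)=m_{32}(m)$, $E_{12}(m)=([m_{12}-m_{11}][m_{11}-m_{22}+1])^{1/2}(m)^{+11}$, $E_{21}(m)=([m_{12}-m_{11}+1][m_{11}-m_{22}])^{1/2}(m)^{-11}$,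 where $(m)^{\pm11}$ is $(m)$ with $m_{11}$ replaced by $m_{11}\pm1$ (square roots $[n]^{1/2}$, $n\in\mathbf{Z}_+$, are fixed once and for all, and roots of products and quotients are formed from these). The induced module $W^q([m_{13},m_{23},m_{33}])$ is $[U_q\otimes V^q]/I^q$, where $V^q=V^q([m_{13},m_{23},m_{33}])$ is made a $U_q(B)$-module by letting $E_{23},E_{13}$ act by zero, $I^q$ is the span of all $ub\otimes v-u\otimes bv$ with $u\in U_q$, $b\in U_q(B)$, $v\in V^q$, and $U_q$ acts by $g(u\otimes v)=gu\otimes v$. Explicitly, as a $U_q[gl(2/1)_0]$-module, $W^q=V_0^q\oplus V_1^q\oplus V_2^q\oplus V_3^q$ with $V^q_0=V^q([m_{13},m_{23},m_{33}])$, $V^q_1=V^q([m_{13},m_{23}-1,m_{33}+1])$, $V^q_2=V^q([m_{13}-1,m_{23},m_{33}+1])$ (absent if $m_{13}=m_{23}$), $V^q_3=V^q([m_{13}-1,m_{23}-1,m_{33}+2])$. Let $(m)=(m)_0$ and $(m)_k$ denote the Gel'fand–Zetlin basis vector of $V_k^q$ with label $m_{11}$ (zero if $m_{11}$ is out of range for $V^q_k$); these form the reduced basis, on which, writing $V_k^q=V^q([m_{12},m_{22},m_{32}])$ (so that $[m_{12},m_{22},m_{32}]$ equals $[m_{13},m_{23},m_{33}]$, $[m_{13},m_{23}-1,m_{33}+1]$, $[m_{13}-1,m_{23},m_{33}+1]$, $[m_{13}-1,m_{23}-1,m_{33}+2]$ for $k=0,1,2,3$ respectively), the even generators act in each $V_k^q$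 by $E_{11}(m)_k=m_{11}(m)_k$, $E_{22}(m)_k=(m_{12}+m_{22}-m_{11})(m)_k$, $E_{33}(m)_k=m_{32}(m)_k$, $E_{12}(m)_k=([m_{12}-m_{11}][m_{11}-m_{22}+1])^{1/2}(m)_k^{+11}$, $E_{21}(m)_k=([m_{12}-m_{11}+1][m_{11}-m_{22}])^{1/2}(m)_k^{-11}$, where $(m)_k^{\pm11}$ is $(m)_k$ with $m_{11}$ replaced by $m_{11}\pm1$. With $l_{11}=m_{11}-1$, $2l=m_{13}-m_{23}$ and $a_1,a_2,a_3$ arbitrary nonzero complex constants (normalizations), the odd generators act by $$E_{23}(m)=0,\quad E_{23}(m)_1=a_1\Big(\tfrac{[l_{11}-l_{23}]}{[2l+1]}\Big)^{1/2}[l_{23}+l_{33}+3](m),\quad E_{23}(m)_2=a_2\Big(\tfrac{[l_{13}-l_{11}]}{[2l]}\Big)^{1/2}[l_{13}+l_{33}+3](m),$$ $$E_{23}(m)_3=a_3\Big\{\tfrac{1}{a_1q}\Big(\tfrac{[l_{13}-l_{11}]}{[2l+1]}\Big)^{1/2}[l_{13}+l_{33}+3](m)_1-\tfrac{1}{a_2q}([l_{11}-l_{23}][2l])^{1/2}\tfrac{[l_{23}+l_{33}+3]}{[2l+1]}(m)_2\Big\},$$ $$E_{32}(m)=\tfrac1{a_1}\Big(\tfrac{[l_{11}-l_{23}]}{[2l+1]}\Big)^{1/2}(m)_1+\tfrac1{a_2}\tfrac{([l_{13}-l_{11}][2l])^{1/2}}{[2l+1]}(m)_2,$$ $$E_{32}(m)_1=\tfrac{a_1q}{a_3}\Big(\tfrac{[l_{13}-l_{11}]}{[2l+1]}\Big)^{1/2}(m)_3,\quad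 E_{32}(m)_2=-\tfrac{a_2q}{a_3}\Big(\tfrac{[l_{11}-l_{23}]}{[2l]}\Big)^{1/2}(m)_3,\quad E_{32}(m)_3=0.$$ The actions of $E_{13},E_{31}$ are determined by their definitions. *)

(* Defs.v *)
From HB Require Import structures.
From mathcomp Require Import all_boot all_order all_algebra.
From mathcomp Require Import complex.
From mathcomp Require Import reals sequences exp trigo.
From mathcomp Require Import ring lra zify.

Set Implicit Arguments.
Unset Strict Implicit.
Unset Printing Implicit Defensive.

Import Order.TTheory GRing.Theory Num.Theory.
Local Open Scope ring_scope.
Local Open Scope complex_scope.

Definition cexp (R : realType) (z : R[i]) : R[i] :=
  let: x +i* y := z in (expR x * cos y) +i* (expR x * sin y).

(* [x] = (q^x - q^-x) / (q - q^-1), where q^x = e^(h x) and q = e^h. *)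
Definition qnum (R : realType) (q h x : R[i]) : R[i] :=
  (cexp (h * x) - cexp (- (h * x))) / (q - q^-1).

Section Brackets.
Context {C : pzRingType} {V : lmodType C}.
Implicit Types (r : C) (A B : V -> V).

Definition comm A B : V -> V := fun v => A (B v) - B (A v).
Definition acomm A B : V -> V := fun v => A (B v) + B (A v).
Definition rcomm r A B : V -> V := fun v => A (B v) - r *: B (A v).

End Brackets.

(* Indices are shifted by one: [Eii 0], [Eii 1], [Eii 2] are E11, E22, E33;   *)
(* [Eup j], [Edown j] are E_{j+1,j+2}, E_{j+2,j+1}; [qE i], [qEinv i] are the *)
(* generators q^{E_ii}, q^{-E_ii}.                                            *)
Inductive Uq_gen : Type :=
  | Eii of 'I_3 | qE of 'I_3 | qEinv of 'I_3 | Eup of 'I_2 | Edown of 'I_2.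

Notation E12 := (Eup (@Ordinal 2 0 isT)).
Notation E23 := (Eup (@Ordinal 2 1 isT)).
Notation E21 := (Edown (@Ordinal 2 0 isT)).
Notation E32 := (Edown (@Ordinal 2 1 isT)).

Definition Uq_wt (i : 'I_3) (j : 'I_2) : int :=
  ((i : nat) == j)%:R - ((i : nat) == j.+1)%:R.

Section UqModule.
Variables (C : fieldType) (q : C).

Section Operators.
Variables (V : lmodType C) (rho : Uq_gen -> V -> V).

Local Notation K i := (rho (qE (@Ordinal 3 i isT))).
Local Notation Kinv i := (rho (qEinv (@Ordinal 3 i isT))).

Definition qnumH1 : V -> V :=
  fun v => (q - q^-1)^-1 *: (K 0 (Kinv 1 v) - Kinv 0 (K 1 v)).
Definition qnumH2 : V -> V :=
  fun v => (q - q^-1)^-1 *: (K 1 (K 2 v) - Kinv 1 (Kinv 2 v)).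

Definition E13 : V -> V := rcomm q^-1 (rho E12) (rho E23).
Definition E31 : V -> V := fun v => - rcomm q^-1 (rho E21) (rho E32) v.

(* A representation of an algebra given by generators and relations is a      *)
(* family of linear operators, indexed by the generators, which satisfies the *)
(* relations.                                                                 *)
Record Uq_relations : Prop := UqRelations {
  Uq_linear : forall g, linear (rho g);
  Uq_EE : forall i j, comm (rho (Eii i)) (rho (Eii j)) =1 \0;
  Uq_qEqE : forall i j, comm (rho (qE i)) (rho (qE j)) =1 \0;
  Uq_qEE : forall i j, comm (rho (qE i)) (rho (Eii j)) =1 \0;
  Uq_qEK : forall i, cancel (rho (qE i)) (rho (qEinv i));
  Uq_qEVK : forall i, cancel (rho (qEinv i)) (rho (qE i));
  Uq_qEup : forall i j v,
    rho (qE i) (rho (Eup j) v) = q ^ Uq_wt i j *: rho (Eup j) (rho (qE i) v);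
  Uq_qEdown : forall i j v,
    rho (qE i) (rho (Edown j) v)
      = q ^ (- Uq_wt i j) *: rho (Edown j) (rho (qE i) v);
  Uq_EEup : forall i j v,
    comm (rho (Eii i)) (rho (Eup j)) v = (Uq_wt i j)%:~R *: rho (Eup j) v;
  Uq_EEdown : forall i j v,
    comm (rho (Eii i)) (rho (Edown j)) v
      = (- Uq_wt i j)%:~R *: rho (Edown j) v;
  Uq_E12E21 : comm (rho E12) (rho E21) =1 qnumH1;
  Uq_E23E32 : acomm (rho E23) (rho E32) =1 qnumH2;
  Uq_E12E32 : comm (rho E12) (rho E32) =1 \0;
  Uq_E21E23 : comm (rho E21) (rho E23) =1 \0;
  Uq_E23E23 : forall v, rho E23 (rho E23 v) = 0;
  Uq_E32E32 : forall v, rho E32 (rho E32 v) = 0;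
  Uq_E12E13 : rcomm q (rho E12) E13 =1 \0;
  Uq_E21E31 : rcomm q (rho E21) E31 =1 \0 }.

End Operators.

Record Uq_module : Type := UqModule {
  Uq_carrier :> lmodType C;
  Uq_act : Uq_gen -> Uq_carrier -> Uq_carrier;
  Uq_actP : Uq_relations Uq_act }.

Definition Uq_submodule (W : Uq_module) (S : {pred W}) : Prop :=
  submod_closed S /\ (forall g v, v \in S -> Uq_act g v \in S).

Definition Uq_irreducible (W : Uq_module) : Prop :=
  (exists v : W, v != 0) /\
  (forall S : {pred W}, Uq_submodule S -> S =i pred1 0 \/ S =i predT).

End UqModule.

Section InducedModule.
Variable R : realType.
Local Notation C := R[i].
Variables (q h : C) (rt : C -> C) (m13 m23 m33 : C) (n : nat) (a1 a2 a3 : C).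

Local Notation qn := (qnum q h).

(* V_k = V([gz_m12 k, gz_m22 k, gz_m32 k]) for k = 0, 1, 2, 3; its dimension  *)
(* gz_m12 k - gz_m22 k + 1 is [gz_dim k] when m13 - m23 = n. In particular    *)
(* V_2 is zero when n = 0.                                                    *)
Definition gz_m12 (k : nat) : C := m13 - [:: 0; 0; 1; 1]`_k.
Definition gz_m22 (k : nat) : C := m23 - [:: 0; 1; 0; 1]`_k.
Definition gz_m32 (k : nat) : C := m33 + [:: 0; 1; 1; 2]`_k.
Definition gz_dim (k : nat) : nat := nth 0%N [:: n.+1; n.+2; n; n.+1] k.

Definition gz_index : Type := {k : 'I_4 & 'I_(gz_dim k)}.
HB.instance Definition _ := Finite.on gz_index.

Definition gz_m11 (i : gz_index) : C := gz_m22 (tag i) + (tagged i)%:R.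

Local Notation gz_space := {ffun gz_index -> C^o}.

(* The vector (m)_k of label m11; it is 0 when m11 is out of range for V_k.   *)
Definition gz (k : nat) (m11 : C) : gz_space :=
  [ffun i : gz_index => (((tag i : nat) == k) && (gz_m11 i == m11))%:R].

Definition gz_wt (i : 'I_3) (k : nat) (m11 : C) : C :=
  [:: m11; gz_m12 k + gz_m22 k - m11; gz_m32 k]`_i.

Definition E12_gz (k : nat) (m11 : C) : gz_space :=
  (rt (qn (gz_m12 k - m11)) * rt (qn (m11 - gz_m22 k + 1))) *: gz k (m11 + 1).

Definition E21_gz (k : nat) (m11 : C) : gz_space :=
  (rt (qn (gz_m12 k - m11 + 1)) * rt (qn (m11 - gz_m22 k))) *: gz k (m11 - 1).

Let l13 : C := m13 - 1.
Let l23 : C := m23 - 2.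
Let l33 : C := m33 - 1.
Let dl : C := m13 - m23. (* 2l *)

Definition E23_gz (k : nat) (m11 : C) : gz_space :=
  let l11 := m11 - 1 in
  match k with
  | 1%N => (a1 * (rt (qn (l11 - l23)) / rt (qn (dl + 1)))
            * qn (l23 + l33 + 3)) *: gz 0 m11
  | 2%N => (a2 * (rt (qn (l13 - l11)) / rt (qn dl))
            * qn (l13 + l33 + 3)) *: gz 0 m11
  | 3%N => a3 *:
      (((a1 * q)^-1 * (rt (qn (l13 - l11)) / rt (qn (dl + 1)))
          * qn (l13 + l33 + 3)) *: gz 1 m11
       - ((a2 * q)^-1 * (rt (qn (l11 - l23)) * rt (qn dl))
          * (qn (l23 + l33 + 3) / qn (dl + 1))) *: gz 2 m11)
  | _ => 0
  end.

Definition E32_gz (k : nat) (m11 : C) : gz_space :=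
  let l11 := m11 - 1 in
  match k with
  | 0%N => (a1^-1 * (rt (qn (l11 - l23)) / rt (qn (dl + 1)))) *: gz 1 m11
       + (a2^-1 * (rt (qn (l13 - l11)) * rt (qn dl) / qn (dl + 1)))
           *: gz 2 m11
  | 1%N => (a1 * q / a3 * (rt (qn (l13 - l11)) / rt (qn (dl + 1)))) *: gz 3 m11
  | 2%N => - (a2 * q / a3 * (rt (qn (l11 - l23)) / rt (qn dl))) *: gz 3 m11
  | _ => 0
  end.

Definition gen_gz (g : Uq_gen) (k : nat) (m11 : C) : gz_space :=
  match g with
  | Eii i => gz_wt i k m11 *: gz k m11
  | qE i => cexp (h * gz_wt i k m11) *: gz k m11
  | qEinv i => cexp (- (h * gz_wt i k m11)) *: gz k m11
  | Eup j => if (j : nat) == 0%N then E12_gz k m11 else E23_gz k m11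
  | Edown j => if (j : nat) == 0%N then E21_gz k m11 else E32_gz k m11
  end.

Definition Wq_act (g : Uq_gen) (v : gz_space) : gz_space :=
  \sum_(i : gz_index) (v i : C) *: gen_gz g (tag i) (gz_m11 i).

End InducedModule.

Section QIdentities.
Variables (F : fieldType) (q X Y M P : F).
Hypotheses (q0 : q != 0) (X0 : X != 0) (Y0 : Y != 0) (M0 : M != 0) (P0 : P != 0).
Hypothesis qq0 : q - q^-1 != 0.

Let pp Y := (X * q / Y - Y / (X * q)) / (q - q^-1).
Let rr Y := (Y - Y^-1) / (q - q^-1).
Let br a b := (q - q^-1)^-1 * (a / b - b / a).

Let q2 : q * q - 1 != 0.
Proof.
apply: contra qq0 => /eqP e; rewrite -[q in q - _]mulr1 -[X in _ * X](divff q0) mulrA.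
by rewrite -[X in _ - X]mul1r -mulrBl e mul0r.
Qed.

Ltac fld := rewrite /br /pp /rr; field; rewrite ?q0 ?X0 ?Y0 ?M0 ?P0 ?q2; by [].

Lemma idH1 k : (k < 4)%N ->
  nth 0 [:: pp (Y / q) * rr (Y / q); pp (Y / q) * rr Y;
            pp Y * rr (Y / q); pp Y * rr Y] k
  - nth 0 [:: pp Y * rr Y; pp Y * rr (Y * q); pp (Y * q) * rr Y;
              pp (Y * q) * rr (Y * q)] k
  = br (M * Y / q) (M * nth 0 [:: X * q * q; X * q; X * q; X] k / (Y * q)).
Proof. by case: k => [|[|[|[|//]]]] _ /=; fld. Qed.

Let x := (M * P - (M * P)^-1) / (q - q^-1).
Let y := (M * P * X * q - (M * P * X * q)^-1) / (q - q^-1).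
Let D := (X * q - (X * q)^-1) / (q - q^-1).

Lemma idH2 :
  rr Y * x + pp Y * y
  = D * ((q - q^-1)^-1 * (M * (X * q * q) / (Y * q) * P
      - (M * (X * q * q) / (Y * q))^-1 / P)).
Proof. by rewrite /x /y /D; fld. Qed.

Lemma idSerre_r : rr Y - (q + q^-1) * rr (Y * q) + rr (Y * q * q) = 0.
Proof. by fld. Qed.

Lemma idSerre_p : pp Y - (q + q^-1) * pp (Y * q) + pp (Y * q * q) = 0.
Proof. by fld. Qed.

End QIdentities.

Section Combinations.
Variables (F : fieldType) (V : lmodType F) (u v : V).
Implicit Types a b c x y z w k l : F.

Lemma comb2 a b x y c z w k l :
  a * (b * x) + c * z = k -> - (a * (b * y)) + c * w = l ->
  a *: (b *: (x *: u - y *: v)) + c *: (z *: u + w *: v) = k *: u + l *: v.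
Proof.
by move=> <- <-; rewrite !(scalerBr, scalerDr) !scalerA !scalerDl scaleNr addrACA !mulrA.
Qed.

Lemma comb2l a b x y c z w k :
  a * (b * x) + c * z = k -> - (a * (b * y)) + c * w = 0 ->
  a *: (b *: (x *: u - y *: v)) + c *: (z *: u + w *: v) = k *: u.
Proof. by move=> kE /(comb2 kE)->; rewrite scale0r addr0. Qed.

Lemma comb2r a b x y c z w l :
  a * (b * x) + c * z = 0 -> - (a * (b * y)) + c * w = l ->
  a *: (b *: (x *: u - y *: v)) + c *: (z *: u + w *: v) = l *: v.
Proof. by move=> k0 /(comb2 k0)->; rewrite scale0r add0r. Qed.

Lemma comb1 b x y z w k : b * (x * z - y * w) = k ->
  b *: (x *: (z *: u) - y *: (w *: u)) = k *: u.
Proof. by move=> <-; rewrite !scalerA -scalerBl scalerA. Qed.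

Lemma comb_comm x y c s1 s1' d1 s2 s2' d2 :
  s1 * d1 = c * s1' -> s2 * d2 = c * s2' ->
  x *: (s1 *: (d1 *: u)) + y *: (s2 *: (d2 *: v))
    - c *: (x *: (s1' *: u) + y *: (s2' *: v)) = 0.
Proof.
move=> e1 e2; apply/eqP; rewrite subr_eq0 scalerDr !scalerA -!mulrA e1 e2.
by rewrite !(mulrCA c).
Qed.

Lemma comb_serre q x y c c' s1 s1' s1'' d1 d1' s2 s2' s2'' d2 d2' : q != 0 ->
  s1 * d1 * d1' - (q + q^-1) * (c * s1' * d1') + c * c' * s1'' = 0 ->
  s2 * d2 * d2' - (q + q^-1) * (c * s2' * d2') + c * c' * s2'' = 0 ->
  (x *: (s1 *: (d1 *: (d1' *: u))) + y *: (s2 *: (d2 *: (d2' *: v)))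
    - q^-1 *: (c *: (x *: (s1' *: (d1' *: u)) + y *: (s2' *: (d2' *: v)))))
  - q *: (c *: (x *: (s1' *: (d1' *: u)) + y *: (s2' *: (d2' *: v)))
    - q^-1 *: (c *: (c' *: (x *: (s1'' *: u) + y *: (s2'' *: v))))) = 0.
Proof.
move=> q0 e1 e2.
transitivity ((x * (s1 * d1 * d1' - (q + q^-1) * (c * s1' * d1') + c * c' * s1'')) *: u
  + (y * (s2 * d2 * d2' - (q + q^-1) * (c * s2' * d2') + c * c' * s2'')) *: v).
  rewrite !(scalerBr, scalerDr) !scalerA !opprD !opprK -![- (_ *: _)]scaleNr.
  set uu := RHS; rewrite !addrA.
  rewrite (AC 8 ((1*3*5*7)*(2*4*6*8))) /= -!scalerDl; congr (_ *: _ + _ *: _).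
    by field.
  by field.
by rewrite e1 e2 !mulr0 !scale0r addr0.
Qed.

Lemma comb1_0 b x y z w : b * (x * z - y * w) = 0 ->
  b *: (x *: (z *: u) - y *: (w *: u)) = 0.
Proof. by move=> /comb1 ->; rewrite scale0r. Qed.

End Combinations.

Section LinearBrackets.
Variables (F : fieldType) (V : lmodType F).
Implicit Types (A B : V -> V) (r : F).

Lemma lin_comp A B : linear A -> linear B -> linear (fun v => A (B v)).
Proof. by move=> lA lB a u v; rewrite lB lA. Qed.

Lemma lin_scale r A : linear A -> linear (fun v => r *: A v).
Proof. by move=> lA a u v; rewrite lA scalerDr !scalerA mulrC. Qed.

Lemma lin_add A B : linear A -> linear B -> linear (fun v => A v + B v).
Proof. by move=> lA lB a u v; rewrite lA lB scalerDr addrACA. Qed.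

Lemma lin_sub A B : linear A -> linear B -> linear (fun v => A v - B v).
Proof. by move=> lA lB a u v; rewrite lA lB scalerBr opprD addrACA. Qed.

Lemma lin_opp A : linear A -> linear (fun v => - A v).
Proof. by move=> lA a u v; rewrite lA opprD scalerN. Qed.

Lemma lin_id : linear (fun v : V => v). Proof. by []. Qed.

Lemma lin_zero : linear (fun v : V => 0 : V).
Proof. by move=> a u v; rewrite scaler0 addr0. Qed.

Lemma lin_comm A B : linear A -> linear B -> linear (comm A B).
Proof. by move=> lA lB; apply: lin_sub; apply: lin_comp. Qed.

Lemma lin_acomm A B : linear A -> linear B -> linear (acomm A B).
Proof. by move=> lA lB; apply: lin_add; apply: lin_comp. Qed.

Lemma lin_rcomm r A B : linear A -> linear B -> linear (rcomm r A B).
Proof.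
by move=> lA lB; apply: lin_sub; [apply: lin_comp|apply/lin_scale/lin_comp].
Qed.

End LinearBrackets.

Section Ladder.
Variables (F : fieldType) (V : lmodType F) (q : F) (A O : {linear V -> V}).
Variables (e : nat -> nat -> V) (c : nat -> nat -> F).
Variables (k l l' : nat) (x y : F) (s s' : nat -> F).
Hypothesis OE : forall t, O (e k t) = x *: (s t *: e l t) + y *: (s' t *: e l' t).

Let AZ a v : A (a *: v) = a *: A v. Proof. exact: linearZ_LR. Qed.
Let OZ a v : O (a *: v) = a *: O v. Proof. exact: linearZ_LR. Qed.
Let AD u v : A (u + v) = A u + A v. Proof. exact: linearD. Qed.
Let AB u v : A (u - v) = A u - A v. Proof. exact: linearB. Qed.
Let Ao : A 0 = 0. Proof. exact: linear0. Qed.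
Let Oo : O 0 = 0. Proof. exact: linear0. Qed.

Lemma raise_comm :
  (forall j t, A (e j t) = c j t *: e j t.+1) ->
  (forall t, s t * c l t = c k t * s t.+1) ->
  (forall t, s' t * c l' t = c k t * s' t.+1) ->
  forall t, comm A O (e k t) = 0.
Proof.
move=> AE h1 h2 t; rewrite /comm OE AE AD !(AZ, OZ) OE !AE.
exact: comb_comm.
Qed.

Lemma lower_comm :
  (forall j, A (e j 0) = 0) -> (forall j t, A (e j t.+1) = c j t *: e j t) ->
  (forall t, s t.+1 * c l t = c k t * s t) ->
  (forall t, s' t.+1 * c l' t = c k t * s' t) ->
  forall t, comm A O (e k t) = 0.
Proof.
move=> A0 AE h1 h2 [|t]; rewrite /comm OE ?A0 ?AE AD !(AZ, OZ) ?A0 ?AE ?Ao ?Oo.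
  by rewrite !scaler0 addr0 subr0.
by rewrite OE; apply: comb_comm.
Qed.

Variable n : nat.
Hypothesis q0 : q != 0.
Hypothesis e_out : forall j t, (n.+1 < t)%N -> e j t = 0.

Lemma raise_serre :
  (forall j t, A (e j t) = c j t *: e j t.+1) ->
  (forall t, (t < n)%N -> s t * c l t * c l t.+1
     - (q + q^-1) * (c k t * s t.+1 * c l t.+1) + c k t * c k t.+1 * s t.+2 = 0) ->
  (forall t, (t < n)%N -> s' t * c l' t * c l' t.+1
     - (q + q^-1) * (c k t * s' t.+1 * c l' t.+1) + c k t * c k t.+1 * s' t.+2 = 0) ->
  forall t, rcomm q A (rcomm q^-1 A O) (e k t) = 0.
Proof.
move=> AE h1 h2 t; rewrite /rcomm !(AB, AZ).
have AO j : A (O (e k j)) = x *: (s j *: (c l j *: e l j.+1)) + y *: (s' j *: (c l' j *: e l' j.+1)).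
  by rewrite OE AD !(AZ, OZ) !AE.
have AAO : A (A (O (e k t))) = x *: (s t *: (c l t *: (c l t.+1 *: e l t.+2)))
   + y *: (s' t *: (c l' t *: (c l' t.+1 *: e l' t.+2))).
  by rewrite AO AD !(AZ, OZ) !AE.
have AOA : A (O (A (e k t))) = c k t *: (x *: (s t.+1 *: (c l t.+1 *: e l t.+2)) + y *: (s' t.+1 *: (c l' t.+1 *: e l' t.+2))).
  by rewrite AE !(AZ, OZ) AO.
have OAA : O (A (A (e k t))) = c k t *: (c k t.+1 *: (x *: (s t.+2 *: e l t.+2) + y *: (s' t.+2 *: e l' t.+2))).
  by rewrite AE !(AZ, OZ) AE !(AZ, OZ) OE.
rewrite AAO AOA OAA.
case: (ltnP t n) => tn; first by apply: comb_serre; [|apply: h1|apply: h2].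
by rewrite !e_out ?(scaler0, addr0, subr0) ?ltnS.
Qed.

Lemma lower_serre :
  (forall j, A (e j 0) = 0) -> (forall j t, A (e j t.+1) = c j t *: e j t) ->
  (forall t, (t < n)%N -> s t.+2 * c l t.+1 * c l t
     - (q + q^-1) * (c k t.+1 * s t.+1 * c l t) + c k t.+1 * c k t * s t = 0) ->
  (forall t, (t < n)%N -> s' t.+2 * c l' t.+1 * c l' t
     - (q + q^-1) * (c k t.+1 * s' t.+1 * c l' t) + c k t.+1 * c k t * s' t = 0) ->
  forall t, rcomm q A (rcomm q^-1 A O) (e k t) = 0.
Proof.
move=> A0 AE h1 h2 t; rewrite /rcomm.
case: (ltnP n.+1 t) => tn; first by rewrite e_out // !(Ao, Oo) !(scaler0, subr0, Ao, Oo).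
have AO0 : A (O (e k 0)) = 0.
  by rewrite OE AD !(AZ, OZ) !A0 !scaler0 addr0.
have AO j : A (O (e k j.+1)) = x *: (s j.+1 *: (c l j *: e l j)) + y *: (s' j.+1 *: (c l' j *: e l' j)).
  by rewrite OE AD !(AZ, OZ) !AE.
case: t tn => [|[|t]] tn; rewrite !(AB, AZ).
- by rewrite AO0 A0 !(Ao, Oo) !(scaler0, subr0).
- by rewrite AO AD !(AZ, OZ) AE !(AZ, OZ) AO0 !A0 !(Ao, Oo) !(scaler0, subr0, addr0).
have AAO : A (A (O (e k t.+2))) = x *: (s t.+2 *: (c l t.+1 *: (c l t *: e l t)))
   + y *: (s' t.+2 *: (c l' t.+1 *: (c l' t *: e l' t))).
  by rewrite AO AD !(AZ, OZ) !AE.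
have AOA : A (O (A (e k t.+2))) = c k t.+1 *: (x *: (s t.+1 *: (c l t *: e l t)) + y *: (s' t.+1 *: (c l' t *: e l' t))).
  by rewrite AE !(AZ, OZ) AO.
have OAA : O (A (A (e k t.+2))) = c k t.+1 *: (c k t *: (x *: (s t *: e l t) + y *: (s' t *: e l' t))).
  by rewrite AE !(AZ, OZ) AE !(AZ, OZ) OE.
rewrite AAO AOA OAA.
by apply: comb_serre; [|apply: h1|apply: h2].
Qed.

End Ladder.

Section Cexp.
Variable R : realType.
Implicit Types x y : R[i].

Lemma cexpD x y : cexp (x + y) = cexp x * cexp y.
Proof.
case: x => a b; case: y => c d; apply/eqP.
rewrite /cexp eq_complex /= expRD cosD sinD.
by apply/andP; split; apply/eqP; ring.
Qed.

Lemma cexp0 : cexp (0 : R[i]) = 1.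
Proof. by apply/eqP; rewrite /cexp eq_complex /= expR0 cos0 sin0 mulr1 mulr0 !eqxx. Qed.

Lemma cexp_neq0 x : cexp x != 0.
Proof.
apply/eqP => x0; have := cexpD x (- x).
by rewrite subrr cexp0 x0 mul0r => /eqP; rewrite oner_eq0.
Qed.

Lemma cexpN x : cexp (- x) = (cexp x)^-1.
Proof.
apply: (mulfI (cexp_neq0 x)); rewrite -cexpD subrr cexp0 divff //.
exact: cexp_neq0.
Qed.

End Cexp.

Section GzBasis.
Variable R : realType.
Local Notation C := R[i].
Variables (q h : C) (rt : C -> C) (m13 m23 m33 : C) (n : nat) (a1 a2 a3 : C).
Local Notation W := {ffun gz_index n -> C^o}.
Local Notation act := (@Wq_act R q h rt m13 m23 m33 n a1 a2 a3).
Local Notation gen_gz := (@gen_gz R q h rt m13 m23 m33 n a1 a2 a3).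
Local Notation e := (@gz R m23 n).
Local Notation qn := (qnum q h).

Fact Wq_act_is_linear g : linear (act g).
Proof.
move=> a u v; rewrite /Wq_act scaler_sumr -big_split /=.
by apply: eq_bigr => i _; rewrite !ffunE scalerA -scalerDl.
Qed.
HB.instance Definition _ g :=
  GRing.isLinear.Build C W W *:%R (act g) (Wq_act_is_linear g).

Lemma gz_m11_inj (i j : gz_index n) :
  (tag i : nat) = tag j -> gz_m11 m23 i = gz_m11 m23 j -> i = j.
Proof.
case: i => k i; case: j => l j /= /ord_inj kl; case: _ / kl j => j.
rewrite /gz_m11 /= => /addrI /eqP; rewrite eqr_nat => /eqP ij.
by congr existT; apply: ord_inj.
Qed.

Lemma gzE (i j : gz_index n) : e (tag i) (gz_m11 m23 i) j = (j == i)%:R.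
Proof.
rewrite ffunE; congr (_ %:R); congr nat_of_bool.
apply/andP/eqP => [[/eqP ki /eqP mi]|->]; last by rewrite !eqxx.
exact: gz_m11_inj.
Qed.

Lemma Wq_act_gz g (i : gz_index n) :
  act g (e (tag i) (gz_m11 m23 i)) = gen_gz g (tag i) (gz_m11 m23 i).
Proof.
rewrite /Wq_act (bigD1 i) //= gzE eqxx scale1r big1 ?addr0 // => j ji.
by rewrite gzE (negbTE ji) scale0r.
Qed.

Lemma gz_sum (v : W) : v = \sum_i (v i : C) *: e (tag i) (gz_m11 m23 i).
Proof.
apply/ffunP => j; have sc (a : C) (u : W) : (a *: u) j = a * u j by rewrite ffunE.
rewrite sum_ffunE (bigD1 j isT) /= (sc (v j)) gzE eqxx mulr1.
by rewrite big1 ?addr0 => [//|i ij]; rewrite (sc (v i)) gzE eq_sym (negbTE ij) mulr0.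
Qed.

(* Reindexing by t = m11 - m23 + 1, which is a natural number for every k.    *)
Definition gzt (k t : nat) : W := e k (m23 - 1 + t%:R).

Definition gz_valid (k t : nat) : bool :=
  let o := nth 0%N [:: 1; 0; 1; 0]%N k in
  [&& k < 4, o <= t & t < o + gz_dim n k]%N.

Lemma gzt_index k t : gz_valid k t ->
  exists2 i : gz_index n, k = tag i & m23 - 1 + t%:R = gz_m11 m23 i.
Proof.
case/and3P=> k4 ot to.
have lt : (t - nth 0 [:: 1; 0; 1; 0] k < gz_dim n (Ordinal k4))%N by rewrite /=; lia.
exists (existT (fun k : 'I_4 => 'I_(gz_dim n k)) (Ordinal k4) (Ordinal lt)) => //.
rewrite /gz_m11 /gz_m22 /= natrB //.
by case: k k4 {ot to lt} => [|[|[|[|]]]] //= _; ring.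
Qed.

Lemma gzt_of_index (i : gz_index n) :
  exists t, [/\ gz_valid (tag i) t, e (tag i) (gz_m11 m23 i) = gzt (tag i) t
    & m23 - 1 + t%:R = gz_m11 m23 i].
Proof.
pose t := (tagged i + nth 0 [:: 1; 0; 1; 0] (tag i))%N.
have tE : m23 - 1 + t%:R = gz_m11 m23 i.
  rewrite /t /gz_m11 /gz_m22 natrD.
  by case: (i) => -[[|[|[|[|]]]]] //= _ j; ring.
exists t; split => //; last by rewrite /gzt tE.
by rewrite /t /gz_valid ltn_ord /=; have := ltn_ord (tagged i); lia.
Qed.

Lemma gzt0 k t : ~~ gz_valid k t -> gzt k t = 0.
Proof.
move=> kt; apply/ffunP => i; rewrite !ffunE; case: eqP => //= ki; case: eqP => // mi.
case: (gzt_of_index i) => s [vs _]; rewrite mi => /addrI /eqP; rewrite eqr_nat => /eqP st.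
by rewrite -ki -st vs in kt.
Qed.

Lemma Wq_act_gzt g k t : gz_valid k t ->
  act g (gzt k t) = gen_gz g k (m23 - 1 + t%:R).
Proof. by case/gzt_index => i -> ti; rewrite /gzt ti Wq_act_gz. Qed.

Lemma gzt_ext (V : lmodType C) (f g : {linear W -> V}) :
  (forall k t, gz_valid k t -> f (gzt k t) = g (gzt k t)) -> f =1 g.
Proof.
move=> fg v; rewrite (gz_sum v) !linear_sum; apply: eq_bigr => i _.
by rewrite !linearZ_LR; case: (gzt_of_index i) => t [vt -> _]; rewrite fg.
Qed.

End GzBasis.

Section WqRelations.
Variable R : realType.
Local Notation C := R[i].
Variables (q h : C) (rt : C -> C) (m13 m23 m33 : C) (n : nat) (a1 a2 a3 : C).
Hypotheses (q_neq0 : q != 0) (q_h : cexp h = q).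
Hypothesis q_nroot : forall k : nat, (0 < k)%N -> q ^+ k != 1.
Hypothesis rtE : forall k : nat, rt (qnum q h k%:R) ^+ 2 = qnum q h k%:R.
Hypothesis m13E : m13 - m23 = n%:R.
Hypotheses (a1_neq0 : a1 != 0) (a2_neq0 : a2 != 0) (a3_neq0 : a3 != 0).

Local Notation W := {ffun gz_index n -> C^o}.
Local Notation act := (@Wq_act R q h rt m13 m23 m33 n a1 a2 a3).
Local Notation e := (@gzt R m23 n).
Local Notation qn := (qnum q h).
Local Notation r k := (rt (qnum q h (k)%:R)).

Lemma cexp_nat k : cexp (h * k%:R) = q ^+ k.
Proof.
elim: k => [|k IH]; first by rewrite mulr0 cexp0.
by rewrite -natr1 mulrDr mulr1 cexpD IH q_h exprSr.
Qed.

Lemma q_qV_neq0 : q - q^-1 != 0.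
Proof.
apply: contra (q_nroot (isT : 0 < 2)%N) => /eqP qq.
by rewrite expr2 -[X in _ * X](subrK q^-1) qq add0r divff.
Qed.

Lemma qnum0 : qn 0 = 0.
Proof. by rewrite /qnum mulr0 oppr0 subrr mul0r. Qed.

Lemma qnum_neq0 k : (0 < k)%N -> qn k%:R != 0.
Proof.
move=> k0; rewrite mulf_neq0 ?invr_eq0 ?q_qV_neq0 // cexpN cexp_nat.
have qk : q ^+ k != 0 by rewrite expf_neq0.
apply: contra (q_nroot (_ : 0 < k + k)%N); last by lia.
by rewrite subr_eq0 exprD => /eqP {2}->; rewrite divff.
Qed.

Lemma r0 : r 0 = 0.
Proof. by apply/eqP; rewrite -(sqrf_eq0 (r 0)) rtE qnum0. Qed.

Lemma r_neq0 k : (0 < k)%N -> r k != 0.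
Proof. by move=> k0; rewrite -(sqrf_eq0 (r k)) rtE qnum_neq0. Qed.

Lemma qnumE x : qn x = (cexp (h * x) - (cexp (h * x))^-1) / (q - q^-1).
Proof. by rewrite /qnum cexpN. Qed.

Lemma m13n : m13 = m23 + n%:R. Proof. by rewrite -m13E addrC subrK. Qed.

Local Notation q1 := (qn (m23 + m33)).
Local Notation q2 := (qn (m13 + m33 + 1)).

(* B = n + 1 - t, as a complex number *)
Local Notation B t := (n.+1%:R - t%:R).

Ltac nf := rewrite /gz_m12 /gz_m22 /gz_m32 /= ?m13n; 
  rewrite -?natr1; ring.

Definition c12 k t : C := nth 0 [:: rt (qn (B t)) * r t; rt (qn (B t)) * r t.+1;
  rt (qn (B t - 1)) * r t; rt (qn (B t - 1)) * r t.+1] k.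

Lemma inv_cases k t : ~~ gz_valid n k t ->
  [\/ (4 <= k)%N, [/\ k = 0%N \/ k = 2%N & t = 0%N],
     ((k < 2) /\ (n.+1 < t))%N | ((1 < k) /\ n < t)%N].
Proof.
rewrite /gz_valid /gz_dim; case: k => [|[|[|[|k]]]] /=; rewrite ?negb_and => nv;
 try by constructor 1.
- case: t nv => [|t] nv; first by constructor 2; split => //; left.
  by constructor 3; lia.
- by constructor 3; lia.
- case: t nv => [|t] nv; first by constructor 2; split => //; right.
  by constructor 4; lia.
- by constructor 4; lia.
Qed.

Lemma actE12 k t : act E12 (e k t) = c12 k t *: e k t.+1.
Proof.
have [v|v] := boolP (gz_valid n k t).
  rewrite Wq_act_gzt //= /E12_gz /gzt; congr (_ *: gz _ _ _ _); last first.
    by rewrite -natr1 addrA.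
  case/and3P: v => k4 _ _; rewrite /c12.
  case: k k4 => [|[|[|[|]]]] //= _; congr (rt (qn _) * rt (qn _)); nf.
rewrite (gzt0 _ v) linear0; case: (inv_cases v) => [k4|[[]-> ->]|[k2 nt]|[k2 nt]].
- by rewrite gzt0 ?scaler0 // /gz_valid /gz_dim negb_and -leqNgt k4.
- by rewrite /c12 /= r0 mulr0 scale0r.
- by rewrite /c12 /= r0 mulr0 scale0r.
- rewrite gzt0 ?scaler0 // /gz_valid /gz_dim; case: (k) k2 => [|[|]] //=; lia.
- rewrite gzt0 ?scaler0 // /gz_valid /gz_dim; case: (k) k2 => [|[|[|[|]]]] //=; lia.
Qed.

Lemma actE21S k t : act E21 (e k t.+1) = c12 k t *: e k t.
Proof.
have [v|v] := boolP (gz_valid n k t.+1).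
  rewrite Wq_act_gzt //= /E21_gz /gzt; congr (_ *: gz _ _ _ _); last first.
    by rewrite -natr1; ring.
  case/and3P: v => k4 _ _; rewrite /c12.
  case: k k4 => [|[|[|[|]]]] //= _; congr (rt (qn _) * rt (qn _)); nf.
rewrite (gzt0 _ v) linear0; case: (inv_cases v) => [k4|[_ //]|[k2 nt]|[k2 nt]].
- by rewrite gzt0 ?scaler0 // /gz_valid /gz_dim negb_and -leqNgt k4.
- have [v'|v'] := boolP (gz_valid n k t); last by rewrite gzt0 // scaler0.
  have tE : t = n.+1 by move: v'; rewrite /gz_valid /gz_dim; case: (k) k2 => [|[|]] //=; lia.
  by rewrite /c12 tE subrr r0; case: (k) k2 => [|[|]] //= _; rewrite mul0r scale0r.
- have [v'|v'] := boolP (gz_valid n k t); last by rewrite gzt0 // scaler0.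
  have tE : t = n.
    by move: v'; rewrite /gz_valid /gz_dim; case: (k) k2 => [|[|[|[|]]]] //=; lia.
  by rewrite /c12 tE -natr1 addrAC subrr add0r subrr r0;
     case: (k) k2 => [|[|[|[|k']]]] //= _; rewrite ?nth_nil ?mul0r scale0r.
Qed.

Lemma actE210 k : act E21 (e k 0) = 0.
Proof.
have [v|v] := boolP (gz_valid n k 0); last by rewrite (gzt0 _ v) linear0.
rewrite Wq_act_gzt //= /E21_gz.
have -> : m23 - 1 + 0%:R - gz_m22 m23 k = 0%:R.
  by case: k v => [|[|[|[|]]]] //= _; rewrite /gz_m22 /=; ring.
by rewrite r0 mulr0 scale0r.
Qed.

Lemma actE23_0 t : act E23 (e 0 t) = 0.
Proof.
have [v|v] := boolP (gz_valid n 0 t); last by rewrite (gzt0 _ v) linear0.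
by rewrite (Wq_act_gzt _ _ _ _ _ _ _ _ _ _ v).
Qed.

Lemma actE32_3 t : act E32 (e 3 t) = 0.
Proof.
have [v|v] := boolP (gz_valid n 3 t); last by rewrite (gzt0 _ v) linear0.
by rewrite (Wq_act_gzt _ _ _ _ _ _ _ _ _ _ v).
Qed.

Lemma AE t : m23 - 1 + t%:R - 1 - (m23 - 2) = t%:R. Proof. ring. Qed.
Lemma BE t : m13 - 1 - (m23 - 1 + t%:R - 1) = B t.
Proof. by rewrite m13n -natr1; ring. Qed.
Lemma dlE : m13 - m23 + 1 = n.+1%:R. Proof. by rewrite m13E natr1. Qed.
Lemma q1E : m23 - 2 + (m33 - 1) + 3 = m23 + m33. Proof. ring. Qed.
Lemma q2E : m13 - 1 + (m33 - 1) + 3 = m13 + m33 + 1. Proof. ring. Qed.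

Lemma e_inv0 k t : ~~ gz_valid n k t -> e k t = 0. Proof. exact: gzt0. Qed.

Lemma rB0 t : t = n.+1 -> rt (qn (B t)) = 0. Proof. by move->; rewrite subrr r0. Qed.

Lemma actE23_1 t :
  act E23 (e 1 t) = (a1 * (r t / r n.+1) * q1) *: e 0 t.
Proof.
have [v|v] := boolP (gz_valid n 1 t).
  by rewrite (Wq_act_gzt _ _ _ _ _ _ _ _ _ _ v) /= (AE t) dlE q1E.
rewrite (gzt0 _ v) linear0 gzt0 ?scaler0 //.
by move: v; rewrite /gz_valid /gz_dim /=; lia.
Qed.

Lemma actE23_2 t :
  act E23 (e 2 t) = (a2 * (rt (qn (B t)) / r n) * q2) *: e 0 t.
Proof.
have [v|v] := boolP (gz_valid n 2 t).
  by rewrite (Wq_act_gzt _ _ _ _ _ _ _ _ _ _ v) /= (BE t) m13E q2E.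
rewrite (gzt0 _ v) linear0.
have [v'|v'] := boolP (gz_valid n 0 t); last by rewrite gzt0 // scaler0.
rewrite rB0 ?(mul0r, mulr0) ?scale0r //.
by move: v v'; rewrite /gz_valid /gz_dim /=; lia.
Qed.

Lemma actE23_3 t :
  act E23 (e 3 t) = a3 *: (((a1 * q)^-1 * (rt (qn (B t)) / r n.+1) * q2) *: e 1 t
    - ((a2 * q)^-1 * (r t * r n) * (q1 / qn n.+1%:R)) *: e 2 t).
Proof.
have [v|v] := boolP (gz_valid n 3 t).
  by rewrite (Wq_act_gzt _ _ _ _ _ _ _ _ _ _ v) /= (BE t) (AE t) dlE m13E q1E q2E.
rewrite (gzt0 _ v) linear0 (@gzt0 _ _ _ 2 t); last first.
  by move: v; rewrite /gz_valid /gz_dim /=; lia.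
have [v'|v'] := boolP (gz_valid n 1 t); last first.
  by rewrite (gzt0 _ v') !scaler0 subr0 scaler0.
rewrite rB0 ?(mul0r, mulr0) ?scale0r ?scaler0 ?subr0 ?scaler0 //.
by move: v v'; rewrite /gz_valid /gz_dim /=; lia.
Qed.

Lemma actE32_0 t :
  act E32 (e 0 t) = (a1^-1 * (r t / r n.+1)) *: e 1 t
    + (a2^-1 * (rt (qn (B t)) * r n / qn n.+1%:R)) *: e 2 t.
Proof.
have [v|v] := boolP (gz_valid n 0 t).
  by rewrite (Wq_act_gzt _ _ _ _ _ _ _ _ _ _ v) /= (BE t) (AE t) dlE m13E.
rewrite (gzt0 _ v) linear0 (@gzt0 _ _ _ 2 t); last first.
  by move: v; rewrite /gz_valid /gz_dim /=; lia.
have [v'|v'] := boolP (gz_valid n 1 t); last first.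
  by rewrite (gzt0 _ v') !scaler0 addr0.
have -> : t = 0%N by move: v v'; rewrite /gz_valid /gz_dim /=; lia.
by rewrite r0 ?(mul0r, mulr0) scale0r scaler0 addr0.
Qed.

Lemma actE32_1 t :
  act E32 (e 1 t) = (a1 * q / a3 * (rt (qn (B t)) / r n.+1)) *: e 3 t.
Proof.
have [v|v] := boolP (gz_valid n 1 t).
  by rewrite (Wq_act_gzt _ _ _ _ _ _ _ _ _ _ v) /= (BE t) dlE.
rewrite (gzt0 _ v) linear0 gzt0 ?scaler0 //.
by move: v; rewrite /gz_valid /gz_dim /=; lia.
Qed.

Lemma actE32_2 t :
  act E32 (e 2 t) = - (a2 * q / a3 * (r t / r n)) *: e 3 t.
Proof.
have [v|v] := boolP (gz_valid n 2 t).
  by rewrite (Wq_act_gzt _ _ _ _ _ _ _ _ _ _ v) /= (AE t) m13E.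
rewrite (gzt0 _ v) linear0.
have [v'|v'] := boolP (gz_valid n 3 t); last by rewrite gzt0 // scaler0.
have -> : t = 0%N by move: v v'; rewrite /gz_valid /gz_dim /=; lia.
by rewrite r0 mul0r mulr0 oppr0 scale0r.
Qed.

Definition wt (i : 'I_3) k t : C := gz_wt m13 m23 m33 i k (m23 - 1 + t%:R).

Lemma actE i k t : act (Eii i) (e k t) = wt i k t *: e k t.
Proof.
have [v|v] := boolP (gz_valid n k t); last by rewrite (gzt0 _ v) !linear0 ?scaler0.
by rewrite (Wq_act_gzt _ _ _ _ _ _ _ _ _ _ v).
Qed.
Lemma actqE i k t : act (qE i) (e k t) = cexp (h * wt i k t) *: e k t.
Proof.
have [v|v] := boolP (gz_valid n k t); last by rewrite (gzt0 _ v) !linear0 ?scaler0.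
by rewrite (Wq_act_gzt _ _ _ _ _ _ _ _ _ _ v).
Qed.
Lemma actqEV i k t : act (qEinv i) (e k t) = (cexp (h * wt i k t))^-1 *: e k t.
Proof.
have [v|v] := boolP (gz_valid n k t); last by rewrite (gzt0 _ v) !linear0 ?scaler0.
by rewrite (Wq_act_gzt _ _ _ _ _ _ _ _ _ _ v) /= cexpN.
Qed.

Lemma wt_shift k k' t t' (i : 'I_3) (w : int) :
  (i = 0 :> nat -> t'%:R = t%:R + w%:~R :> C) ->
  (i = 1%N :> nat -> gz_m12 m13 k' + gz_m22 m23 k' - t'%:R
     = gz_m12 m13 k + gz_m22 m23 k - t%:R + w%:~R) ->
  (i = 2%N :> nat -> gz_m32 m33 k' = gz_m32 m33 k + w%:~R) ->
  wt i k' t' = wt i k t + w%:~R.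
Proof.
rewrite /wt /gz_wt; case: i => -[|[|[|]]] //= _ h0 h1 h2.
- by rewrite h0 // addrA.
- transitivity (gz_m12 m13 k' + gz_m22 m23 k' - t'%:R - (m23 - 1)); first by ring.
  by rewrite h1 //; ring.
- exact: h2.
Qed.

Ltac wt_tac := let ii := fresh "ii" in
  apply: wt_shift => /= ii; rewrite /Uq_wt ii /gz_m12 /gz_m22 /gz_m32
  /= -?natr1; ring.

Lemma wt_op (G : {linear W -> W}) (phi : C -> C) (i : 'I_3) :
  (forall k t, G (e k t) = phi (wt i k t) *: e k t) ->
  forall (j : 'I_2) k t, (k < 4)%N ->
   G (act (Eup j) (e k t)) = phi (wt i k t + (Uq_wt i j)%:~R) *: act (Eup j) (e k t)
   /\ G (act (Edown j) (e k t))
       = phi (wt i k t + (- Uq_wt i j)%:~R) *: act (Edown j) (e k t).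
Proof.
move=> GE j k t k4.
have key c k' t' w : wt i k' t' = wt i k t + w%:~R ->
    G (c *: e k' t') = phi (wt i k t + w%:~R) *: (c *: e k' t').
  by move=> wE; rewrite linearZ_LR GE wE !scalerA mulrC.
case: j => -[|[|//]] j2; rewrite (bool_irrelevance j2 isT) {j2}; split.
- by rewrite actE12; apply: key; wt_tac.
- case: t key => [|t] key; first by rewrite actE210 !linear0 ?scaler0.
  by rewrite actE21S; apply: key; wt_tac.
- case: k k4 key => [|[|[|[|//]]]] _ key.
  + by rewrite actE23_0 !linear0 ?scaler0.
  + by rewrite actE23_1; apply: key; wt_tac.
  + by rewrite actE23_2; apply: key; wt_tac.
  + rewrite actE23_3 linearZ_LR linearB [RHS]scalerA [phi _ * _]mulrC -[RHS]scalerA.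
    congr (_ *: _); rewrite scalerBr.
    by congr (_ - _); apply: key; wt_tac.
- case: k k4 key => [|[|[|[|//]]]] _ key.
  + by rewrite actE32_0 linearD scalerDr; congr (_ + _); apply: key; wt_tac.
  + by rewrite actE32_1; apply: key; wt_tac.
  + by rewrite actE32_2; apply: key; wt_tac.
  + by rewrite actE32_3 !linear0 ?scaler0.
Qed.

Local Opaque gzt Wq_act.

Local Notation p t := (rt (qn (B t))).
Local Notation M := (cexp (h * m23)).
Local Notation P := (cexp (h * m33)).

Lemma c12E k t : c12 k t = nth 0 [:: p t * r t; p t * r t.+1; p t.+1 * r t; p t.+1 * r t.+1] k.
Proof. by rewrite /c12; have -> : B t - 1 = B t.+1 :> C by ring. Qed.

Lemma cexpM u v x : x = m23 + u%:R - v%:R -> cexp (h * x) = M * q ^+ u / q ^+ v.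
Proof. by move->; rewrite mulrDr cexpD mulrDr cexpD mulrN cexpN !cexp_nat. Qed.

Lemma cexpP u x : x = m33 + u%:R -> cexp (h * x) = P * q ^+ u.
Proof. by move->; rewrite mulrDr cexpD cexp_nat. Qed.

Lemma cexpMP u v x : x = m23 + m33 + u%:R - v%:R ->
  cexp (h * x) = M * P * q ^+ u / q ^+ v.
Proof. by move->; rewrite mulrDr cexpD mulrDr cexpD mulrDr cexpD mulrN cexpN !cexp_nat. Qed.

Lemma cexpB u v x : x = u%:R - v%:R -> cexp (h * x) = q ^+ u / q ^+ v.
Proof. by move->; rewrite mulrDr cexpD mulrN cexpN !cexp_nat. Qed.

Local Notation o3 i := (@Ordinal 3 i isT).

Lemma Qwt0 k t : cexp (h * wt (o3 0) k t) = M * q ^+ t / q.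
Proof. by rewrite (@cexpM t 1) //; rewrite /wt /gz_wt /=; ring. Qed.

Lemma Qwt1 k t : (k < 4)%N ->
  cexp (h * wt (o3 1) k t) = M * q ^+ nth 0 [:: n.+2; n.+1; n.+1; n] k / (q ^+ t * q).
Proof.
move=> k4; rewrite (@cexpM (nth 0 [:: n.+2; n.+1; n.+1; n] k) t.+1) ?exprSr //.
rewrite /wt /gz_wt /gz_m12 /gz_m22 /=.
by case: k k4 => [|[|[|[|//]]]] _ /=; rewrite m13n -?natr1; ring.
Qed.

Lemma Qwt2 k t : (k < 4)%N ->
  cexp (h * wt (o3 2) k t) = P * q ^+ nth 0 [:: 0; 1; 1; 2]%N k.
Proof.
move=> k4; rewrite (@cexpP (nth 0 [:: 0; 1; 1; 2]%N k)) //.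
by rewrite /wt /gz_wt /gz_m32 /=; case: k k4 => [|[|[|[|//]]]].
Qed.

Lemma qnB u v : qn (u%:R - v%:R) = (q ^+ u / q ^+ v - q ^+ v / q ^+ u) / (q - q^-1).
Proof. by rewrite qnumE (cexpB (erefl _)) invf_div. Qed.

Lemma qnN u : qn u%:R = (q ^+ u - (q ^+ u)^-1) / (q - q^-1).
Proof. by rewrite qnumE cexp_nat. Qed.

Lemma p2 t : (t <= n.+1)%N ->
  p t ^+ 2 = (q ^+ n * q / q ^+ t - q ^+ t / (q ^+ n * q)) / (q - q^-1).
Proof. by move=> tn; rewrite -natrB // rtE natrB // qnB exprSr. Qed.

Lemma r2 t : r t ^+ 2 = (q ^+ t - (q ^+ t)^-1) / (q - q^-1).
Proof. by rewrite rtE qnN. Qed.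

Lemma actZ g a (v : W) : act g (a *: v) = a *: act g v.
Proof. exact: linearZ_LR. Qed.
Lemma actD g (u v : W) : act g (u + v) = act g u + act g v.
Proof. exact: linearD. Qed.
Lemma actB g (u v : W) : act g (u - v) = act g u - act g v.
Proof. exact: linearB. Qed.
Lemma act0 g : act g 0 = 0.
Proof. exact: linear0. Qed.

Lemma qnumH1E k t : qnumH1 q act (e k t) =
  ((q - q^-1)^-1 * (cexp (h * wt (o3 0) k t) / cexp (h * wt (o3 1) k t)
    - cexp (h * wt (o3 1) k t) / cexp (h * wt (o3 0) k t))) *: e k t.
Proof.
rewrite /qnumH1 actqEV actqE !actZ actqE actqEV !scalerA -scalerBl scalerA.
by congr ((_ * (_ - _)) *: _); rewrite mulrC.
Qed.

Lemma qnumH2E k t : qnumH2 q act (e k t) =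
  ((q - q^-1)^-1 * (cexp (h * wt (o3 1) k t) * cexp (h * wt (o3 2) k t)
    - (cexp (h * wt (o3 1) k t))^-1 / cexp (h * wt (o3 2) k t))) *: e k t.
Proof.
rewrite /qnumH2 actqEV actqE !actZ actqE actqEV !scalerA -scalerBl scalerA.
by congr ((_ * (_ - _)) *: _); rewrite mulrC.
Qed.

Lemma expq_neq0 k : q ^+ k != 0. Proof. by rewrite expf_neq0. Qed.
Lemma M0 : M != 0. Proof. exact: cexp_neq0. Qed.
Lemma P0 : P != 0. Proof. exact: cexp_neq0. Qed.

Lemma relE12E21 k t : gz_valid n k t ->
  comm (act E12) (act E21) (e k t) = qnumH1 q act (e k t).
Proof.
move=> v; have k4 : (k < 4)%N by case/and3P: v.
rewrite qnumH1E /comm.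
rewrite Qwt0 Qwt1 // actE12 actZ actE21S scalerA.
have -> : act E12 (act E21 (e k t)) =
   (if t is s.+1 then c12 k s ^+ 2 else 0) *: e k t.
  case: (t) => [|s]; first by rewrite actE210 act0 scale0r.
  by rewrite actE21S actZ actE12 scalerA.
rewrite -scalerBl; congr (_ *: _); rewrite -expr2.
have c2 s : c12 k s ^+ 2 = nth 0 [:: p s ^+ 2 * r s ^+ 2; p s ^+ 2 * r s.+1 ^+ 2;
  p s.+1 ^+ 2 * r s ^+ 2; p s.+1 ^+ 2 * r s.+1 ^+ 2] k.
  by rewrite c12E; case: k k4 {v} => [|[|[|[|//]]]] _ /=; rewrite exprMn.
have := idH1 q_neq0 (expq_neq0 n) (expq_neq0 t) M0 q_qV_neq0 k4.
have -> : nth 0 [:: q ^+ n * q * q; q ^+ n * q; q ^+ n * q; q ^+ n] k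
   = q ^+ nth 0 [:: n.+2; n.+1; n.+1; n] k.
  by case: (k) k4 => [|[|[|[|//]]]] _ /=; rewrite ?exprSr.
move<-; congr (_ - _).
{ case: t v => [|s] v; rewrite ?c2; case: k k4 v {c2} => [|[|[|[|//]]]] _.
  all: rewrite /gz_valid /gz_dim /= => v //.
  - by rewrite expr0 invr1 subrr mul0r mulr0.
  - by rewrite expr0 invr1 subrr mul0r mulr0.
  all: rewrite !p2 ?r2; try lia.
  all: by rewrite exprSr ?mulfK. }
rewrite c2; case: k k4 v {c2} => [|[|[|[|//]]]] _.
all: rewrite /gz_valid /gz_dim /= => v //.
all: rewrite ?p2 ?r2; try lia.
all: by rewrite ?exprSr.
Qed.

Local Notation R1 := (r n.+1).

Lemma q1_cexp : q1 = (M * P - (M * P)^-1) / (q - q^-1).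
Proof. by rewrite qnumE mulrDr cexpD. Qed.

Lemma q2_cexp : q2 = (M * P * q ^+ n * q - (M * P * q ^+ n * q)^-1) / (q - q^-1).
Proof.
by rewrite qnumE m13n !mulrDr mulr1 !cexpD cexp_nat q_h (mulrAC _ _ P).
Qed.

Lemma actE23_3' t :
  act E23 (e 3 t) = a3 *: (((a1 * q)^-1 * (p t / R1) * q2) *: e 1 t
    - ((a2 * q)^-1 * (r t * r n) * (q1 / R1 ^+ 2)) *: e 2 t).
Proof. by rewrite actE23_3 rtE. Qed.

Lemma actE32_0' t :
  act E32 (e 0 t) = (a1^-1 * (r t / R1)) *: e 1 t
    + (a2^-1 * (p t * r n / R1 ^+ 2)) *: e 2 t.
Proof. by rewrite actE32_0 rtE. Qed.

Lemma R1_neq0 : R1 != 0. Proof. exact: r_neq0. Qed.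

Lemma qnumH2_gzt k t : (k < 4)%N -> (t <= n.+1)%N ->
  qnumH2 q act (e k t) = ((r t ^+ 2 * q1 + p t ^+ 2 * q2) / R1 ^+ 2) *: e k t.
Proof.
move=> k4 tn; rewrite qnumH2E Qwt1 // Qwt2 //; congr (_ *: _).
apply: (mulfI (x := R1 ^+ 2)); first by rewrite expf_neq0 ?R1_neq0.
rewrite [in RHS]mulrC (mulfVK (expf_neq0 2 R1_neq0)) q1_cexp q2_cexp p2 // !r2.
rewrite exprSr (idH2 q_neq0 (expq_neq0 n) (expq_neq0 t) M0 P0 q_qV_neq0).
congr (_ * (_ * _)); have -> : M * (q ^+ n * q * q) / (q ^+ t * q) * P
  = M * q ^+ nth 0%N [:: n.+2; n.+1; n.+1; n] k / (q ^+ t * q) * (P * q ^+ nth 0%N [:: 0; 1; 1; 2]%N k).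
  by case: k k4 => [|[|[|[|//]]]] _ /=; rewrite ?exprSr; ring.
by rewrite -!invfM; congr (_ - _^-1);
  case: k k4 => [|[|[|[|//]]]] _ /=; rewrite ?exprSr; ring.
Qed.

Lemma rn_neq0 : (0 < n)%N -> r n != 0. Proof. exact: r_neq0. Qed.

Lemma relE23E32 k t : gz_valid n k t ->
  acomm (act E23) (act E32) (e k t) = qnumH2 q act (e k t).
Proof.
move=> v; have k4 : (k < 4)%N by case/and3P: v.
have tn : (t <= n.+1)%N.
  by case: (k) k4 v => [|[|[|[|//]]]] _; rewrite /gz_valid /gz_dim /=; lia.
have R10 := R1_neq0; have nn := rn_neq0.
rewrite qnumH2_gzt // /acomm; case: k k4 v => [|[|[|[|//]]]] _.
all: rewrite /gz_valid /gz_dim /= => v.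
- rewrite actE32_0' actE23_0 act0 addr0 actD !actZ actE23_1 actE23_2 !scalerA -scalerDl.
  congr (_ *: _); have [n0|n0] := posnP n.
    have -> : p t = 0 by apply: rB0; lia.
    rewrite !(mulr0, mul0r, expr0n) ?(mulr0, mul0r) ?addr0.
    by field; rewrite ?a1_neq0 ?R10.
  by field; rewrite nn // a1_neq0 a2_neq0 R10.
- rewrite actE32_1 actE23_1 !actZ actE23_3' actE32_0'.
  apply: comb2l.
    by field; rewrite ?q_neq0 ?a1_neq0 ?a2_neq0 ?a3_neq0 ?R10.
  by field; rewrite ?q_neq0 ?a1_neq0 ?a2_neq0 ?a3_neq0 ?R10.
- have n0 : (0 < n)%N by lia.
  rewrite actE32_2 actE23_2 !actZ actE23_3' actE32_0'.
  apply: comb2r; last first.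
    by field; rewrite ?q_neq0 ?a1_neq0 ?a2_neq0 ?a3_neq0 ?R10 ?nn.
  by field; rewrite ?q_neq0 ?a1_neq0 ?a2_neq0 ?a3_neq0 ?R10 ?nn.
- rewrite actE32_3 act0 add0r actE23_3' actZ actB !actZ actE32_1 actE32_2.
  apply: comb1; have [n0|n0] := posnP n.
    have -> : t = 0%N by lia.
    rewrite r0 !(mulr0, mul0r, expr0n) ?(mulr0, mul0r) ?oppr0 ?mulr0 ?subr0 ?add0r.
    by field; rewrite ?q_neq0 ?a1_neq0 ?a2_neq0 ?a3_neq0 ?R10 ?nn.
  by field; rewrite ?q_neq0 ?a1_neq0 ?a2_neq0 ?a3_neq0 ?R10 ?nn.
Qed.

Let s (b : bool) t : C := if b then r t else p t.

Let upE : seq (nat * nat * bool) :=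
  [:: (1, 0, true); (2, 0, false); (3, 1, false); (3, 2, true)]%N.
Let downE : seq (nat * nat * bool) :=
  [:: (0, 1, true); (0, 2, false); (1, 3, false); (2, 3, true)]%N.

Lemma serre_s b t : (t < n)%N ->
  s b t ^+ 2 - (q + q^-1) * s b t.+1 ^+ 2 + s b t.+2 ^+ 2 = 0.
Proof.
move=> tn; case: b => /=; rewrite ?r2 ?p2; try lia; rewrite !exprSr.
  exact: (idSerre_r q_neq0 (expq_neq0 t) q_qV_neq0).
exact: (idSerre_p q_neq0 (expq_neq0 n) (expq_neq0 t) q_qV_neq0).
Qed.

Lemma up_comm k l b t : (k, l, b) \in upE ->
  s b t.+1 * c12 l t = c12 k t * s b t.
Proof.
by rewrite !inE => /or4P[] /eqP[-> -> ->]; rewrite !c12E /s /=; ring.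
Qed.

Lemma down_comm k l b t : (k, l, b) \in downE ->
  s b t * c12 l t = c12 k t * s b t.+1.
Proof.
by rewrite !inE => /or4P[] /eqP[-> -> ->]; rewrite !c12E /s /=; ring.
Qed.

Lemma up_serre k l b t : (t < n)%N -> (k, l, b) \in upE ->
  s b t * c12 l t * c12 l t.+1 - (q + q^-1) * (c12 k t * s b t.+1 * c12 l t.+1)
    + c12 k t * c12 k t.+1 * s b t.+2 = 0.
Proof.
move=> tn kl; have e := serre_s b tn.
transitivity ((if b then if k == 3%N then p t.+1 * p t.+2 * r t.+1 else p t * p t.+1 * r t.+1
   else if k == 3%N then p t.+1 * r t.+1 * r t.+2 else p t.+1 * r t * r t.+1)
  * (s b t ^+ 2 - (q + q^-1) * s b t.+1 ^+ 2 + s b t.+2 ^+ 2)); last by rewrite e mulr0.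
by move: kl; rewrite !inE => /or4P[] /eqP[-> -> ->]; rewrite !c12E /s /=; ring.
Qed.

Lemma down_serre k l b t : (t < n)%N -> (k, l, b) \in downE ->
  s b t.+2 * c12 l t.+1 * c12 l t
    - (q + q^-1) * (c12 k t.+1 * s b t.+1 * c12 l t)
    + c12 k t.+1 * c12 k t * s b t = 0.
Proof.
move=> tn kl; have e := serre_s b tn.
transitivity ((if b then if k == 0%N then p t * p t.+1 * r t.+1 else p t.+1 * p t.+2 * r t.+1
   else if k == 0%N then p t.+1 * r t * r t.+1 else p t.+1 * r t.+1 * r t.+2)
  * (s b t ^+ 2 - (q + q^-1) * s b t.+1 ^+ 2 + s b t.+2 ^+ 2)); last by rewrite e mulr0.
by move: kl; rewrite !inE => /or4P[] /eqP[-> -> ->]; rewrite !c12E /s /=; ring.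
Qed.

Lemma E23_form k : (0 < k < 4)%N -> exists x y l l' b b',
  [/\ (k, l, b) \in upE, (k, l', b') \in upE
    & forall t, act E23 (e k t) = x *: (s b t *: e l t) + y *: (s b' t *: e l' t)].
Proof.
case: k => [|[|[|[|//]]]] // _.
- exists (a1 / R1 * q1), 0, 0%N, 0%N, true, true; split=> // t.
  by rewrite actE23_1 scale0r addr0 scalerA; congr (_ *: _); rewrite /s; ring.
- exists (a2 / r n * q2), 0, 0%N, 0%N, false, false; split=> // t.
  by rewrite actE23_2 scale0r addr0 scalerA; congr (_ *: _); rewrite /s; ring.
- exists (a3 * ((a1 * q)^-1 / R1 * q2)), (- (a3 * ((a2 * q)^-1 * r n * (q1 / R1 ^+ 2)))),
    1%N, 2%N, false, true; split=> // t.
  rewrite actE23_3' scalerBr !scalerA -scaleNr.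
  by congr (_ *: _ + _ *: _); rewrite /s; ring.
Qed.

Lemma E32_form k : (k < 3)%N -> exists x y l l' b b',
  [/\ (k, l, b) \in downE, (k, l', b') \in downE
    & forall t, act E32 (e k t) = x *: (s b t *: e l t) + y *: (s b' t *: e l' t)].
Proof.
case: k => [|[|[|//]]] // _.
- exists (a1^-1 / R1), (a2^-1 * r n / R1 ^+ 2), 1%N, 2%N, true, false; split=> // t.
  by rewrite actE32_0' !scalerA; congr (_ *: _ + _ *: _); rewrite /s; ring.
- exists (a1 * q / a3 / R1), 0, 3%N, 3%N, false, false; split=> // t.
  by rewrite actE32_1 scale0r addr0 scalerA; congr (_ *: _); rewrite /s; ring.
- exists (- (a2 * q / a3 / r n)), 0, 3%N, 3%N, true, true; split=> // t.
  by rewrite actE32_2 scale0r addr0 scalerA; congr (_ *: _); rewrite /s; ring.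
Qed.

Lemma relE12E32 k t : (k < 4)%N -> comm (act E12) (act E32) (e k t) = 0.
Proof.
case: (ltnP k 3) => k3 k4; last first.
  have -> : k = 3%N by lia.
  by rewrite /comm actE32_3 actE12 actZ actE32_3 act0 scaler0 subr0.
have [x [y [l [l' [b [b' [h1 h2 E]]]]]]] := E32_form k3.
by apply: (raise_comm E actE12) => j; apply: down_comm.
Qed.

Lemma relE21E23 k t : (k < 4)%N -> comm (act E21) (act E23) (e k t) = 0.
Proof.
case: (posnP k) => k0 k4.
  rewrite k0 /comm; case: t => [|t].
    by rewrite actE23_0 actE210 !act0 subr0.
  by rewrite actE23_0 actE21S actZ actE23_0 act0 scaler0 subr0.
have [x [y [l [l' [b [b' [h1 h2 E]]]]]]] := E23_form (introT andP (conj k0 k4)).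
by apply: (lower_comm E actE210 actE21S) => j; apply: up_comm.
Qed.

Lemma gzt_out k t : (n.+1 < t)%N -> e k t = 0.
Proof.
move=> nt; apply: gzt0; rewrite /gz_valid /gz_dim.
by case: k => [|[|[|[|k]]]] //=; lia.
Qed.

Lemma relE12E13 k t : (k < 4)%N -> rcomm q (act E12) (E13 q act) (e k t) = 0.
Proof.
rewrite /E13; case: (posnP k) => k0 k4.
  by rewrite k0 /rcomm !(actE23_0, actE12, actZ, act0, scaler0, subr0).
have [x [y [l [l' [b [b' [h1 h2 E]]]]]]] := E23_form (introT andP (conj k0 k4)).
by apply: (raise_serre E q_neq0 gzt_out actE12) => j jn; apply: up_serre.
Qed.

Lemma relE21E31 k t : (k < 4)%N ->
  rcomm q (act E21) (rcomm q^-1 (act E21) (act E32)) (e k t) = 0.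
Proof.
move=> k4; case: (ltnP k 3) => k3; last first.
  have -> : k = 3%N by lia.
  rewrite /rcomm; case: t => [|[|t]].
  - by rewrite actE32_3 actE210 !act0 scaler0 !subr0 !act0 scaler0 subr0.
  - by rewrite actE32_3 actE21S !actZ actE32_3 actE210 !act0 !scaler0 !subr0 !act0 !scaler0 subr0.
  by rewrite actE32_3 !actE21S !actZ !actE21S !actZ !actE32_3 !act0 !scaler0 !subr0 !act0 !scaler0 subr0.
have [x [y [l [l' [b [b' [h1 h2 E]]]]]]] := E32_form k3.
by apply: (lower_serre E q_neq0 gzt_out actE210 actE21S) => j jn; apply: down_serre.
Qed.

Lemma relE23E23 k t : gz_valid n k t -> act E23 (act E23 (e k t)) = 0.
Proof.
have R10 := R1_neq0; have nn := rn_neq0.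
move=> v; have k4 : (k < 4)%N by case/and3P: v.
case: k k4 v => [|[|[|[|//]]]] _; rewrite /gz_valid /gz_dim /= => v.
- by rewrite actE23_0 act0.
- by rewrite actE23_1 actZ actE23_0 scaler0.
- by rewrite actE23_2 actZ actE23_0 scaler0.
rewrite actE23_3' actZ actB !actZ actE23_1 actE23_2.
apply: comb1_0; have [n0|n0] := posnP n.
  have -> : t = 0%N by lia.
  by rewrite r0 !(mulr0, mul0r) subr0 mulr0.
by field; rewrite ?q_neq0 ?a1_neq0 ?a2_neq0 ?R10 ?nn.
Qed.

Lemma relE32E32 k t : gz_valid n k t -> act E32 (act E32 (e k t)) = 0.
Proof.
have R10 := R1_neq0; have nn := rn_neq0.
move=> v; have k4 : (k < 4)%N by case/and3P: v.
case: k k4 v => [|[|[|[|//]]]] _; rewrite /gz_valid /gz_dim /= => v.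
- rewrite actE32_0' actD !actZ actE32_1 actE32_2 !scalerA -scalerDl.
  rewrite [X in X *: _](_ : _ = 0) ?scale0r //; have [n0|n0] := posnP n.
    have -> : p t = 0 by apply: rB0; lia.
    by rewrite !(mulr0, mul0r) addr0.
  by field; rewrite ?q_neq0 ?a1_neq0 ?a2_neq0 ?a3_neq0 ?R10 ?nn.
- by rewrite actE32_1 actZ actE32_3 scaler0.
- by rewrite actE32_2 actZ actE32_3 scaler0.
- by rewrite actE32_3 act0.
Qed.

Lemma act_ext (f g : W -> W) : linear f -> linear g ->
  (forall k t, (k < 4)%N -> gz_valid n k t -> f (e k t) = g (e k t)) -> f =1 g.
Proof.
move=> lf lg fg.
pose mf := GRing.isLinear.Build C W W *:%R f lf.
pose mg := GRing.isLinear.Build C W W *:%R g lg.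
pose F : {linear W -> W} := HB.pack f mf.
pose G : {linear W -> W} := HB.pack g mg.
apply: (@gzt_ext R m23 n W F G) => k t v.
by apply: fg => //; case/and3P: v.
Qed.

Let la g : linear (act g) := Wq_act_is_linear _ _ _ _ _ _ _ _ _ g.

Lemma wt_up i j k t : (k < 4)%N ->
  act (Eii i) (act (Eup j) (e k t))
    = (wt i k t + (Uq_wt i j)%:~R) *: act (Eup j) (e k t).
Proof. move=> k4; case: (@wt_op (act (Eii i)) id i (actE i) j k t k4) => HU HD; exact: HU. Qed.

Lemma wt_down i j k t : (k < 4)%N ->
  act (Eii i) (act (Edown j) (e k t))
    = (wt i k t + (- Uq_wt i j)%:~R) *: act (Edown j) (e k t).
Proof. move=> k4; case: (@wt_op (act (Eii i)) id i (actE i) j k t k4) => HU HD; exact: HD. Qed.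

Lemma qwt_up i j k t : (k < 4)%N ->
  act (qE i) (act (Eup j) (e k t))
    = cexp (h * (wt i k t + (Uq_wt i j)%:~R)) *: act (Eup j) (e k t).
Proof.
move=> k4; case: (@wt_op (act (qE i)) (fun x => cexp (h * x)) i (actqE i) j k t k4) => HU HD; exact: HU.
Qed.

Lemma qwt_down i j k t : (k < 4)%N ->
  act (qE i) (act (Edown j) (e k t))
    = cexp (h * (wt i k t + (- Uq_wt i j)%:~R)) *: act (Edown j) (e k t).
Proof.
move=> k4; case: (@wt_op (act (qE i)) (fun x => cexp (h * x)) i (actqE i) j k t k4) => HU HD; exact: HD.
Qed.

Lemma cexp_int (z : int) : cexp (h * z%:~R) = q ^ z.
Proof.
case: z => k; first by rewrite -pmulrn cexp_nat.
by rewrite NegzE mulrNz -pmulrn mulrN cexpN cexp_nat -exprnN.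
Qed.

Theorem Wq_relations : Uq_relations q act.
Proof.
split; try exact: la.
- move=> i j; apply: act_ext; [by apply: lin_comm; exact: la|exact: lin_zero|].
  move=> k t _ _; rewrite /comm !actE !actZ !actE !scalerA mulrC subrr //.
- move=> i j; apply: act_ext; [by apply: lin_comm; exact: la|exact: lin_zero|].
  move=> k t _ _; rewrite /comm !actqE !actZ !actqE !scalerA mulrC subrr //.
- move=> i j; apply: act_ext; [by apply: lin_comm; exact: la|exact: lin_zero|].
  move=> k t _ _; rewrite /comm actE actqE !actZ actE actqE !scalerA mulrC subrr //.
- move=> i; apply: (@act_ext (fun v => act (qEinv i) (act (qE i) v)) id);
    [by apply: lin_comp; exact: la|exact: lin_id|].
  move=> k t _ _; rewrite actqE actZ actqEV scalerA mulfV ?scale1r //.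
  exact: cexp_neq0.
- move=> i; apply: (@act_ext (fun v => act (qE i) (act (qEinv i) v)) id);
    [by apply: lin_comp; exact: la|exact: lin_id|].
  move=> k t _ _; rewrite actqEV actZ actqE scalerA mulVf ?scale1r //.
  exact: cexp_neq0.
- move=> i j; apply: act_ext; [by apply: lin_comp; exact: la| |].
    by apply: lin_scale; apply: lin_comp; exact: la.
  move=> k t k4 _; rewrite qwt_up // actqE actZ scalerA.
  by congr (_ *: _); rewrite mulrDr cexpD cexp_int mulrC.
- move=> i j; apply: act_ext; [by apply: lin_comp; exact: la| |].
    by apply: lin_scale; apply: lin_comp; exact: la.
  move=> k t k4 _; rewrite qwt_down // actqE actZ scalerA.
  by congr (_ *: _); rewrite mulrDr cexpD cexp_int mulrC.
- move=> i j; apply: act_ext; [by apply: lin_comm; exact: la| |].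
    by apply: lin_scale; exact: la.
  move=> k t k4 _; rewrite /comm wt_up // actE actZ -scalerBl.
  by congr (_ *: _); rewrite addrAC subrr add0r.
- move=> i j; apply: act_ext; [by apply: lin_comm; exact: la| |].
    by apply: lin_scale; exact: la.
  move=> k t k4 _; rewrite /comm wt_down // actE actZ -scalerBl.
  by congr (_ *: _); rewrite addrAC subrr add0r.
- apply: act_ext; [by apply: lin_comm; exact: la| |].
    by apply: lin_scale; apply: lin_sub; apply: lin_comp; exact: la.
  by move=> k t _; exact: relE12E21.
- apply: act_ext; [by apply: lin_acomm; exact: la| |].
    by apply: lin_scale; apply: lin_sub; apply: lin_comp; exact: la.
  by move=> k t _; exact: relE23E32.
- apply: act_ext; [by apply: lin_comm; exact: la|exact: lin_zero|].
  by move=> k t k4 _; exact: relE12E32.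
- apply: act_ext; [by apply: lin_comm; exact: la|exact: lin_zero|].
  by move=> k t k4 _; exact: relE21E23.
- apply: act_ext; [by apply: lin_comp; exact: la|exact: lin_zero|].
  by move=> k t _; exact: relE23E23.
- apply: act_ext; [by apply: lin_comp; exact: la|exact: lin_zero|].
  by move=> k t _; exact: relE32E32.
- apply: act_ext; [|exact: lin_zero|].
    by do ?[apply: lin_rcomm]; exact: la.
  by move=> k t k4 _; exact: relE12E13.
- have E v : rcomm q (act E21) (E31 q act) v
     = - rcomm q (act E21) (rcomm q^-1 (act E21) (act E32)) v.
    by rewrite /E31 {1 3}/rcomm /= linearN /= scalerN opprK opprB addrC.
  move=> v; rewrite E (_ : rcomm _ _ _ _ = 0) ?oppr0 //.
  move: v; apply: act_ext; [|exact: lin_zero|].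
    by do ?[apply: lin_rcomm]; exact: la.
  by move=> k t k4 _; exact: relE21E31.
Qed.

(* The induced module U_q (x)_{U_q(B)} V([m13, m23, m33]), where E23 and E13   *)
(* act by zero on V, given by its matrix elements in the reduced basis; V is  *)
(* identified with V_0.                                                       *)
Definition Wq : Uq_module q := UqModule Wq_relations.

End WqRelations.

(* Main.v *)
Require Import Defs.
From HB Require Import structures.
From mathcomp Require Import all_boot all_order all_algebra.
From mathcomp Require Import complex.
From mathcomp Require Import reals.
From mathcomp Require Import ring zify.

Set Implicit Arguments.
Unset Strict Implicit.
Unset Printing Implicit Defensive.

Import Order.TTheory GRing.Theory Num.Theory.
Local Open Scope ring_scope.
Local Open Scope complex_scope.

(** The module is small enough to be understood vector by vector, because its
    reduced basis is a joint eigenbasis with simple joint spectrum. The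
    operator [E11] reads off [m11] and [E33] reads off the degree (0 for
    [V_0], 1 for [V_1] and [V_2], 2 for [V_3]), so that the only coincidences
    are between the vectors of [V_1] and [V_2] with equal [m11]; these are told
    apart by the Casimir-like operator [E21 E12] of the even subalgebra. Hence
    a submodule contains every basis vector that occurs in one of its members
    ([simple_spectrum_basis], [submodule_coord]), and submodules correspond to
    the sets of basis vectors which are closed under following the nonzero
    matrix elements.

    Write [q1 = [l23 + l33 + 3]] and [q2 = [l13 + l33 + 3]]. Since q is not a
    root of unity, every other factor of a matrix element is nonzero away from
    the ends of the Gel'fand-Zetlin patterns. Inside one block [V_k] the even
    generators connect everything ([submodule_block]). Between blocks, [E32]
    leads from [V_0] to [V_1] and [V_2] and from there to [V_3], always with
    nonzero coefficients, whereas the way back by [E23] carries the factor [q1]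
    on the arrows [V_1 -> V_0] and [V_3 -> V_2], and [q2] on the arrows
    [V_2 -> V_0] and [V_3 -> V_1]. If both are nonzero, every block is reachable
    from every other one ([submodule_all_gzt]). If [q1 = 0], nothing leaves
    [V_1 + V_3]; if [q2 = 0], nothing leaves [V_2 + V_3]; both miss
    [V_0] and contain [V_3], and neither of these blocks is zero
    ([block_span_not_irreducible]). *)

(** * Submodules under operators with simple joint spectrum *)

(** Take a vector of smallest support among those of [S] with nonzero [i]-th
    coordinate: if [j] were another point of its support, applying [D - d j]
    for an operator that separates [j] from [i] would kill the [j]-th
    coordinate, rescale the others, and leave the [i]-th one nonzero. So the
    support is [i] alone. Induction on the size of the support replaces
    minimality. *)
Lemma simple_spectrum_basis (F : fieldType) (I : finType)
  (S : {pred {ffun I -> F^o}}) :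
  submod_closed S ->
  (forall i j : I, i != j -> exists D : {ffun I -> F^o} -> {ffun I -> F^o},
     exists d : I -> F,
     [/\ {in S, forall v, D v \in S},
         forall (v : {ffun I -> F^o}) k, D v k = d k * v k & d i != d j]) ->
  forall (v : {ffun I -> F^o}) i, v \in S -> v i != 0 ->
  [ffun j => (j == i)%:R] \in S.
Proof.
move=> [S0 SL] sep v i.
have [m] := ubnP #|[set j | v j != 0]|; elim: m v => // m IH v vm vS vi.
have [/existsP[j /andP[ji vj]]|] := boolP [exists j, (j != i) && (v j != 0)].
  have [D [d [DS Dd dij]]] := sep _ _ ji.
  pose u : {ffun I -> F^o} := (- d j) *: v + D v.
  have uE k : u k = (d k - d j) * v k.
    have -> : u k = (- d j) * v k + D v k by rewrite !ffunE.
    by rewrite Dd -mulrDl addrC.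
  apply: (IH u).
  - rewrite -ltnS; apply: leq_trans vm; rewrite ltnS; apply: proper_card.
    apply/properP; split.
      by apply/subsetP => k; rewrite !inE uE mulf_eq0 negb_or => /andP[].
    by exists j; rewrite ?inE ?uE ?subrr ?mul0r ?eqxx.
  - exact/SL/DS.
  by rewrite uE mulf_neq0 // subr_eq0 eq_sym.
rewrite negb_exists => /forallP v0.
rewrite (_ : [ffun _ => _] = (v i)^-1 *: v + 0); first exact: SL.
apply/ffunP => j; rewrite addr0 [RHS]ffunE ffunE -[RHS]/((v i)^-1 * v j).
move/(_ j): v0.
have [->|ji] /= := eqVneq j i; first by rewrite mulVf.
by rewrite negbK => /eqP ->; rewrite mulr0.
Qed.

(** * Matrix elements in the reduced basis *)

Lemma gz_valid01 n : gz_valid n 0 1. Proof. by []. Qed.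
Lemma gz_valid10 n : gz_valid n 1 0. Proof. by []. Qed.
Lemma gz_valid11 n : gz_valid n 1 1. Proof. by []. Qed.
Lemma gz_valid30 n : gz_valid n 3 0. Proof. by []. Qed.

Lemma gz_valid2 n t : gz_valid n 2 t -> (0 < n)%N /\ gz_valid n 2 1.
Proof. by rewrite /gz_valid /gz_dim /=; lia. Qed.

Section Typicality.
Variable R : realType.
Local Notation C := R[i].
Variables (q h : C) (rt : C -> C) (m13 m23 m33 : C) (n : nat) (a1 a2 a3 : C).
Hypotheses (q_neq0 : q != 0) (q_h : cexp h = q).
Hypothesis q_nroot : forall k : nat, (0 < k)%N -> q ^+ k != 1.
Hypothesis rtE : forall k : nat, rt (qnum q h k%:R) ^+ 2 = qnum q h k%:R.
Hypothesis m13E : m13 - m23 = n%:R.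
Hypotheses (a1_neq0 : a1 != 0) (a2_neq0 : a2 != 0) (a3_neq0 : a3 != 0).

Local Notation W := {ffun gz_index n -> C^o}.
Local Notation act := (@Wq_act R q h rt m13 m23 m33 n a1 a2 a3).
Local Notation e := (@gzt R m23 n).
Local Notation qn := (qnum q h).
(* On the vector of V_k with m11 = m23 - 1 + t, the radicands of the matrix
   elements are [t] = [l11 - l23] and [n + 1 - t] = [l13 - l11], up to shifts of
   t by one. *)
Local Notation r k := (rt (qn (k)%:R)).
Local Notation p t := (rt (qn (n.+1%:R - t%:R))).
(* [l23 + l33 + 3] and [l13 + l33 + 3] *)
Local Notation q1 := (qn (m23 + m33)).
Local Notation q2 := (qn (m13 + m33 + 1)).
Local Notation c := (c12 q h rt n).
Local Notation Wq := (Wq m33 q_neq0 q_h q_nroot rtE m13E a1_neq0 a2_neq0 a3_neq0).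

Let rn0 s : (0 < s)%N -> r s != 0.
Proof. exact: (r_neq0 q_neq0 q_h q_nroot rtE a1_neq0 a2_neq0 a3_neq0). Qed.

Let qn0 s : (0 < s)%N -> qn s%:R != 0.
Proof. exact: (qnum_neq0 q_neq0 q_h q_nroot a1_neq0 a2_neq0 a3_neq0). Qed.

Lemma p_neq0 t : (t <= n)%N -> p t != 0.
Proof.
move=> tn; rewrite -natrB; last by lia.
by apply: rn0; lia.
Qed.

(* The head symbol decides which lemma applies: trying them by unification would
   unfold the arithmetic of complex numbers. *)
Ltac coef_neq0 := repeat lazymatch goal with
  | |- is_true (_ * _ != 0) => apply: mulf_neq0
  | |- is_true (_^-1 != 0) => apply: invr_neq0
  | |- is_true (rt (qn (_ - _)) != 0) => apply: p_neq0; first [done | lia]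
  | |- is_true (rt _ != 0) => apply: rn0; first [done | lia]
  | |- is_true (qn _%:R != 0) => apply: qn0; first [done | lia]
  | _ => assumption
  end.

Lemma gzt_neq0 k t : gz_valid n k t -> e k t != 0.
Proof.
move=> v; have [i -> ti] := gzt_index m23 v; rewrite /gzt ti.
by apply/eqP => /ffunP/(_ i); rewrite gzE eqxx ffunE => /eqP; rewrite oner_eq0.
Qed.

Lemma c12_neq0 k t : gz_valid n k t -> gz_valid n k t.+1 -> c k t != 0.
Proof.
rewrite /gz_valid /gz_dim c12E.
by case: k => [|[|[|[|]]]] //= v v'; coef_neq0.
Qed.

(** With [b = n + 1 - t], the difference of the two eigenvalues of [E21 E12] is
    [[b][t + 1] - [b - 1][t] = [b + t] = [n + 1]], independently of [t]. The
    bounds on [t] say that both [V_1] and [V_2] have a vector there. *)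
Lemma c12_sqr_separates t : (0 < t <= n)%N -> c 1 t ^+ 2 != c 2 t ^+ 2.
Proof.
move=> /andP[t0 tn]; rewrite -subr_eq0 (_ : _ - _ = qn n.+1%:R).
  exact: qn0.
have tn1 : (t <= n.+1)%N by lia.
have q0 := expq_neq0 q_neq0.
have qq1 : q * q - 1 != 0 by rewrite -expr2 subr_eq0 q_nroot.
rewrite !c12E /= !exprMn !(p2 q_h rtE) // !(r2 q_h rtE) (qnN q_h).
by rewrite !exprSr; field; rewrite ?q0 ?q_neq0 ?qq1.
Qed.

Lemma E21E12_gzt k t : act E21 (act E12 (e k t)) = c k t ^+ 2 *: e k t.
Proof. by rewrite actE12 // actZ actE21S // scalerA expr2. Qed.

(** Turns the eigenvector equations on the basis into the coordinatewise form
    in which [simple_spectrum_basis] wants its separating operators. *)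
Lemma diagonal_coord (D : {linear W -> W}) (d : gz_index n -> C) :
  (forall i : gz_index n, D (gz m23 n (tag i) (gz_m11 m23 i))
     = d i *: gz m23 n (tag i) (gz_m11 m23 i)) ->
  forall (v : W) i, D v i = d i * v i.
Proof.
move=> DE v i; rewrite {1}(gz_sum m23 v) linear_sum sum_ffunE (bigD1 i) //=.
have sc (x : C) (u : W) j : (x *: u) j = x * u j by rewrite ffunE.
rewrite linearZ_LR DE !sc gzE eqxx mulr1 big1 ?addr0 1?mulrC // => j ji.
by rewrite linearZ_LR DE !sc gzE eq_sym (negbTE ji) !mulr0.
Qed.

(** * Submodules in the typical case *)

Section Submodule.
Variable S : {pred Wq}.
Hypothesis S_sub : Uq_submodule S.

Let S0 : (0 : W) \in S. Proof. by case: S_sub => -[]. Qed.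
Let SZ (a : C) (v : W) : v \in S -> a *: v \in S.
Proof. by move=> vS; rewrite -[_ *: _]addr0; case: S_sub => -[_ SL] _; exact: SL. Qed.
Let Sact g (v : W) : v \in S -> act g v \in S.
Proof. by case: S_sub => _ SA /SA; exact. Qed.
Let SZK (a : C) (v : W) : a != 0 -> a *: v \in S -> v \in S.
Proof. by move=> a0 /(SZ a^-1); rewrite scalerK. Qed.

(** The three separating operators are tried in turn: [E11], then [E33], then
    [E21 E12] for a pair of vectors from [V_1] and [V_2]. *)
Lemma submodule_coord (v : W) (i : gz_index n) : v \in S -> v i != 0 ->
  gz m23 n (tag i) (gz_m11 m23 i) \in S.
Proof.
move=> vS vi; rewrite (_ : gz _ _ _ _ = [ffun j => (j == i)%:R]); last first.
  by apply/ffunP => j; rewrite gzE ffunE.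
apply: (simple_spectrum_basis (proj1 S_sub) _ vS vi) => {v vS vi i} i j ij.
have [m11E|m11N] := eqVneq (gz_m11 m23 i) (gz_m11 m23 j); last first.
  exists (act (Eii (@Ordinal 3 0 isT))), (@gz_m11 R m23 n); split=> //.
    by move=> v; apply: Sact.
  by apply: diagonal_coord => k; exact: Wq_act_gz.
have [m32E|m32N] := eqVneq (gz_m32 m33 (tag i)) (gz_m32 m33 (tag j)); last first.
  exists (act (Eii (@Ordinal 3 2 isT))).
  exists (fun i : gz_index n => gz_m32 m33 (tag i)); split=> //.
    by move=> v; apply: Sact.
  by apply: diagonal_coord => k; exact: Wq_act_gz.
(* u i is the label t such that m11 = m23 - 1 + t *)
pose u (i : gz_index n) := (tagged i + nth 0 [:: 1; 0; 1; 0] (tag i))%N.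
exists (fun v => act E21 (act E12 v)), (fun i : gz_index n => c (tag i) (u i) ^+ 2).
have uE k : m23 - 1 + (u k)%:R = gz_m11 m23 k.
  by rewrite /u /gz_m11 /gz_m22 natrD; case: (k) => -[[|[|[|[|]]]]] //= _ l; ring.
split; first by move=> v vS; do 2!apply: Sact.
  apply: (@diagonal_coord (act E21 \o act E12)) => k /=.
  by rewrite -uE; exact: E21E12_gzt.
have tij : (tag i : nat) != tag j.
  by apply: contra ij => /eqP tij; apply/eqP/(gz_m11_inj tij m11E).
have uij : u i = u j.
  by move: m11E; rewrite -!uE => /addrI /eqP; rewrite eqr_nat => /eqP.
have := @gzt_of_index R m23 n i; have := @gzt_of_index R m23 n j.
move=> [t [vj _ tE]] [t' [vi _ tE']].
have {tE} tE : t = u j by move: tE; rewrite -uE => /addrI /eqP; rewrite eqr_nat => /eqP.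
have {tE'} tE' : t' = u j.
  by move: tE'; rewrite -uE uij => /addrI /eqP; rewrite eqr_nat => /eqP.
subst t t'; rewrite uij.
have m32lv (k : 'I_4) : gz_m32 m33 k = m33 + (nth 0 [:: 0; 1; 1; 2] k)%N%:R.
  by rewrite /gz_m32; case: k => -[|[|[|[|]]]].
move: m32E; rewrite !m32lv => /addrI /eqP; rewrite eqr_nat.
move: (u j) vi vj tij; rewrite /gz_valid /gz_dim => t.
case: (tag i) => -[|[|[|[|]]]] //= _; case: (tag j) => -[|[|[|[|]]]] //= _ vi vj _ _.
  by apply: c12_sqr_separates; lia.
by rewrite eq_sym; apply: c12_sqr_separates; lia.
Qed.

(** No cancellation can hide a basis vector in a combination of two of them that
    lie in different blocks. This is the form in which [E32] on [V_0] and [E23]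
    on [V_3] are used. *)
Lemma submodule_gzt k t k' t' (x y : C) : gz_valid n k t -> k != k' -> x != 0 ->
  x *: e k t + y *: e k' t' \in S -> e k t \in S.
Proof.
move=> v; have [i -> ti] := gzt_index m23 v => kk' x0; rewrite /gzt ti => vS.
apply: (submodule_coord vS).
have -> (u w : W) : (x *: u + y *: w) i = x * u i + y * w i by rewrite !ffunE.
by rewrite gzE eqxx mulr1 ffunE (negbTE kk') mulr0 addr0.
Qed.

Lemma submodule_block k t t' : gz_valid n k t -> gz_valid n k t' ->
  e k t \in S -> e k t' \in S.
Proof.
have step s d : gz_valid n k s -> gz_valid n k (s + d) ->
    (e k s \in S) = (e k (s + d) \in S).
  elim: d s => [|d IH] s vs vsd; first by rewrite addn0.
  have vs1 : gz_valid n k s.+1 by move: vs vsd; rewrite /gz_valid; lia.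
  rewrite addnS -addSn -IH //; last by rewrite addSn -addnS.
  have c0 := c12_neq0 vs vs1.
  apply/idP/idP => /Sact eS.
    by apply: (SZK c0); rewrite -(actE12 m33 q_neq0 rtE m13E a1_neq0 a2_neq0 a3_neq0) eS.
  by apply: (SZK c0); rewrite -(actE21S m33 q_neq0 rtE m13E a1_neq0 a2_neq0 a3_neq0) eS.
move=> v v'; case: (leqP t t') => [tt'|/ltnW tt'].
  by have := step t (t' - t)%N v; rewrite subnKC // => ->.
by have := step t' (t - t')%N v'; rewrite subnKC // => ->.
Qed.

Hypotheses (q1_neq0 : q1 != 0) (q2_neq0 : q2 != 0).

(** Any block leads back to [V_0] and [V_0] leads to all the others. The passage
    between two blocks is made at a label where the square-root factor does not
    vanish: [t = 1] lies in [V_0], [V_1] and [V_2] (the latter if [n > 0]), and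
    [t = 0] lies in [V_1] and [V_3]. *)
Lemma submodule_all_gzt k t k' t' : gz_valid n k t -> e k t \in S ->
  gz_valid n k' t' -> e k' t' \in S.
Proof.
have e11_e01 : e 1 1 \in S -> e 0 1 \in S.
  move/(Sact E23); rewrite actE23_1 //; apply: SZK.
  by coef_neq0.
move=> v eS v'.
have {v eS} e01 : e 0 1 \in S.
  have k4 : (k < 4)%N by case/and3P: v.
  case: k k4 v eS => [|[|[|[|//]]]] _ v eS.
  - exact: submodule_block eS.
  - exact/e11_e01/(submodule_block v).
  - have [n0 v21] := gz_valid2 v; have := Sact E23 (submodule_block v v21 eS).
    rewrite actE23_2 //; apply: SZK.
    by coef_neq0.
  - apply/e11_e01/(submodule_block (gz_valid10 n)) => //.
    have := Sact E23 (submodule_block v (gz_valid30 n) eS).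
    rewrite actE23_3 // => /(SZK a3_neq0); rewrite -scaleNr.
    apply: submodule_gzt => //.
    by coef_neq0.
have := Sact E32 e01; rewrite actE32_0 // => e12.
have e11 : e 1 1 \in S.
  by apply: submodule_gzt e12 => //; coef_neq0.
have k4 : (k' < 4)%N by case/and3P: v'.
case: k' k4 v' => [|[|[|[|//]]]] _ v'.
- exact: submodule_block e01.
- exact: submodule_block e11.
- have [n0 v21] := gz_valid2 v'; apply: (submodule_block v21) => //.
  move: e12; rewrite addrC; apply: submodule_gzt => //.
  by coef_neq0.
- apply: (submodule_block (gz_valid30 n)) => //.
  have := Sact E32 (submodule_block (gz_valid11 n) (gz_valid10 n) e11).
  rewrite actE32_1 //; apply: SZK.
  by coef_neq0.
Qed.

(** Searching the finite basis for a member of [S] decides between the two cases: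
    by [submodule_coord], a submodule without basis vectors is zero. *)
Lemma submodule_trivial : S =i pred1 (0 : W) \/ S =i predT.
Proof.
have [/existsP[i iS]|] := boolP [exists i : gz_index n,
    gz m23 n (tag i) (gz_m11 m23 i) \in S].
  right=> v; rewrite [RHS]inE (gz_sum m23 v).
  elim/big_ind: _ => [//|u w uS wS|j _].
    by rewrite -[u]scale1r; case: S_sub => -[_ SL] _; exact: SL.
  apply: SZ; move: iS.
  have [t [vi -> _]] := gzt_of_index m23 i.
  have [t' [vj -> _]] := gzt_of_index m23 j.
  by move=> iS; exact: (submodule_all_gzt vi iS vj).
rewrite negb_exists => /forallP noS; left=> v; rewrite [RHS]inE.
apply/idP/eqP => [vS|-> //]; apply/ffunP => i; rewrite [RHS]ffunE.
have [/eqP//|vi] := boolP ((v : W) i == 0).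
by have := submodule_coord vS vi; rewrite (negbTE (noS i)).
Qed.

End Submodule.

(** * Proper submodules in the atypical case *)

(** The sum of the blocks [V_k] for [k] in [K]. *)
Definition block_span (K : seq nat) : {pred Wq} :=
  [pred v : W |
    [forall i : gz_index n, ((tag i : nat) \notin K) ==> (v i == 0)]].

Lemma block_span_gzt K k t : k \in K -> e k t \in block_span K.
Proof.
move=> kK; apply/forallP => i; apply/implyP => iK; rewrite ffunE.
case: (eqVneq (tag i : nat) k) iK => [->|_ _]; first by rewrite kK.
exact: eqxx.
Qed.

Lemma block_span_submod K : submod_closed (block_span K).
Proof.
split=> [|a u v /forallP uK /forallP vK].
  by apply/forallP => i; apply/implyP => _; rewrite ffunE.
apply/forallP => i; apply/implyP => iK.
have -> : (a *: u + v) i = a * (u : W) i + (v : W) i by rewrite !ffunE.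
by rewrite (eqP (implyP (uK i) iK)) (eqP (implyP (vK i) iK)) mulr0 addr0.
Qed.

Lemma block_span0 K : (0 : W) \in block_span K.
Proof. exact: (proj1 (block_span_submod K)). Qed.

Lemma block_spanZ K (a : C) (v : W) :
  v \in block_span K -> a *: v \in block_span K.
Proof.
by move=> vK; rewrite -[_ *: _]addr0; apply: (proj2 (block_span_submod K)) => //;
  exact: block_span0.
Qed.

(** The even generators preserve each block, so only the odd ones matter. *)
Lemma block_span_submodule K :
  (forall k t, k \in K -> act E23 (e k t) \in block_span K) ->
  (forall k t, k \in K -> act E32 (e k t) \in block_span K) ->
  Uq_submodule (block_span K).
Proof.
have [_ KL] := block_span_submod K => K23 K32.
split; first exact: block_span_submod.
move=> g v /forallP vK.
have KG k t : k \in K -> act g (e k t) \in block_span K.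
  move=> kK; have eK t' := block_span_gzt t' kK.
  case: g => [i|i|i|j|j].
  - by rewrite actE; exact: block_spanZ.
  - by rewrite actqE; exact: block_spanZ.
  - by rewrite actqEV; exact: block_spanZ.
  - case: j => -[|[|//]] j2; rewrite (bool_irrelevance j2 isT); last exact: K23.
    by rewrite actE12 //; exact: block_spanZ.
  - case: j => -[|[|//]] j2; rewrite (bool_irrelevance j2 isT); last exact: K32.
    case: t => [|t]; first by rewrite actE210 // block_span0.
    by rewrite actE21S //; exact: block_spanZ.
change (act g v \in block_span K).
rewrite (gz_sum m23 v) linear_sum; elim/big_ind: _ => [|u w uK wK|i _].
- exact: block_span0.
- by rewrite -[u]scale1r; exact: KL.
rewrite linearZ_LR; have [iK|iK] := boolP ((tag i : nat) \in K).
  by apply: block_spanZ; have [t [_ -> _]] := gzt_of_index m23 i; exact: KG.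
have K0 (x : C) (w : W) : x = 0 -> x *: w \in block_span K.
  by move->; rewrite scale0r block_span0.
by apply: K0; apply/eqP; exact: (implyP (vK i) iK).
Qed.

Lemma block_span_not_irreducible (K : seq nat) : 3 \in K -> 0%N \notin K ->
  Uq_submodule (block_span K) -> ~ Uq_irreducible Wq.
Proof.
move=> K3 K0 Ksub [_ /(_ _ Ksub)[KE|KE]].
  have := block_span_gzt 0 K3; rewrite KE inE; apply/negP; exact: gzt_neq0.
have [i i0 ti] := gzt_index m23 (gz_valid01 n).
have := KE (e 0 1); rewrite [RHS]inE => /forallP/(_ i).
by rewrite -i0 K0 /gzt ti i0 gzE eqxx oner_eq0.
Qed.

Lemma irreducible_iff : Uq_irreducible Wq <-> q1 != 0 /\ q2 != 0.
Proof.
split=> [irr|[q10 q20]]; last first.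
  split; last by move=> S /submodule_trivial; exact.
  by exists (e 0 1); exact: gzt_neq0.
split; apply/eqP => q0; move: irr.
  apply: (@block_span_not_irreducible [:: 1; 3]%N) => //.
  apply: block_span_submodule => k t; rewrite !inE => /orP[] /eqP->.
  - by rewrite actE23_1 // q0 mulr0 scale0r; exact: block_span0.
  - rewrite actE23_3 // q0 mul0r mulr0 scale0r subr0.
    by do 2!apply: block_spanZ; exact: block_span_gzt.
  - by rewrite actE32_1 //; apply: block_spanZ; exact: block_span_gzt.
  - by rewrite actE32_3; exact: block_span0.
apply: (@block_span_not_irreducible [:: 2; 3]%N) => //.
apply: block_span_submodule => k t; rewrite !inE => /orP[] /eqP->.
- by rewrite actE23_2 // q0 mulr0 scale0r; exact: block_span0.
- rewrite actE23_3 // q0 mulr0 scale0r sub0r -scaleNr.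
  by do 2!apply: block_spanZ; exact: block_span_gzt.
- by rewrite actE32_2 //; apply: block_spanZ; exact: block_span_gzt.
- by rewrite actE32_3; exact: block_span0.
Qed.

End Typicality.

Theorem proposition4 (R : realType)
  (q h : R[i]) (q_neq0 : q != 0) (q_h : cexp h = q)
  (q_nroot : forall k : nat, (0 < k)%N -> q ^+ k != 1)
  (rt : R[i] -> R[i])
  (rtE : forall k : nat, rt (qnum q h k%:R) ^+ 2 = qnum q h k%:R)
  (m13 m23 m33 : R[i]) (n : nat) (m13E : m13 - m23 = n%:R)
  (a1 a2 a3 : R[i]) (a1_neq0 : a1 != 0) (a2_neq0 : a2 != 0) (a3_neq0 : a3 != 0) :
  let l13 := m13 - 1 in
  let l23 := m23 - 2 in
  let l33 := m33 - 1 in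
  Uq_irreducible
    (Wq m33 q_neq0 q_h q_nroot rtE m13E a1_neq0 a2_neq0 a3_neq0)
  <-> qnum q h (l13 + l33 + 3) * qnum q h (l23 + l33 + 3) != 0.
Proof.
move=> l13 l23 l33; rewrite irreducible_iff q1E q2E.
split=> [[q1_neq0 q2_neq0]|]; first exact: mulf_neq0.
by rewrite mulf_eq0 negb_or => /andP[].
Qed.
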